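(* For every polynomial $p$ with real coefficients there exist a finite configuration $A\subseteq\mathbb N^n$ and a Markov basis $M$ of $I_A$ such that $\deg_{Gr_A}>p(\deg_{\mathcal C_A})$, $\deg_{Gr_A}>p(\deg_{\mathcal U_A})$ and $\deg_{Gr_A}>p(\deg_M)$. That is, the degrees of the elements of the Graver basis of a toric ideal cannot be bounded above by a polynomial in the maximal degree of the circuits, in the maximal degree of the elements of a Markov basis, or in the maximal degree of the elements of the universal Gröbner basis.
   Context: Let $\mathbb K$ be a field and $A=\{\mathbf a_1,\dots,\mathbf a_m\}\subseteq\mathbb Z^n$ finite. For $\mathbf u\in\mathbb N^m$, $\mathbf x^{\mathbf u}=x_1^{u_1}\cdots x_m^{u_m}$ has degree $u_1+\dots+u_m$ and $A$-degree $\sum u_i\mathbf a_i$. The toric ideal $I_A\subseteq\mathbb K[x_1,\dots,x_m]$ is generated by all binomials $\mathbf x^{\mathbf u}-\mathbf x^{\mathbf v}$ of equal $A$-degree. The degree of a binomial $\mathbf x^{\mathbf u}-\mathbf x^{\mathbf v}$ is the maximum of the degrees of its two monomials. $Gr_A$ (Graver basis) is the set of primitive binomials: irreducible binomials $\mathbf x^{\mathbf u}-\mathbf x^{\mathbf v}\in I_A$ for which no other binomial $\mathbf x^{\mathbf w}-\mathbf x^{\mathbf z}\in I_A$ has $\mathbf x^{\mathbf w}\mid\mathbf x^{\mathbf u}$, $\mathbf x^{\mathbf z}\mid\mathbf x^{\mathbf v}$. $\mathcal U_A$ is the union of all reduced Gröbner bases of $I_A$. $\mathcal C_A$ is the set of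 circuits, i.e. irreducible nonzero binomials of $I_A$ with minimal support. A Markov basis is a generating set of $I_A$ of binomials minimal under inclusion. For a finite set $S$ of binomials, $\deg_S$ denotes the maximal degree of its elements; $\deg_{Gr_A},\deg_{\mathcal U_A},\deg_{\mathcal C_A}$ are defined accordingly. *)

(* Defs.v *)
From mathcomp Require Import all_boot all_order all_algebra.
From mathcomp Require Import boolp classical_sets reals.
From mathcomp Require Import mpoly.

Set Implicit Arguments.
Unset Strict Implicit.
Unset Printing Implicit Defensive.

Import Order.TTheory GRing.Theory Num.Theory.
Local Open Scope ring_scope.
Local Open Scope classical_set_scope.

Definition irreducible (R : comUnitRingType) (x : R) : Prop :=
  [/\ x != 0, x \isn't a GRing.unit
    & forall y z, x = y * z -> y \is a GRing.unit \/ z \is a GRing.unit].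

Definition ideal_gen (R : comPzRingType) (S : set R) : set R :=
  [set f | exists (k : nat) (c g : 'I_k -> R),
     (forall i, S (g i)) /\ f = \sum_(i < k) c i * g i].

Section Polynomials.
Variables (K : fieldType) (m : nat).
Implicit Types (f g h : {mpoly K[m]}) (u v w z : 'X_{1..m}).
Implicit Types (S I M : set {mpoly K[m]}) (G : seq {mpoly K[m]}).
Implicit Type (le : rel 'X_{1..m}).

(* [msize f] is one more than the total degree of a nonzero [f]. *)
Definition tdeg f : nat := (msize f).-1.

Lemma tdeg_binomial u v : u != v ->
  tdeg ('X_[u] - 'X_[v]) = maxn (mdeg u) (mdeg v).
Proof.
move=> neq_uv; have su : u \in msupp ('X_[K, u] - 'X_[v]).
  by rewrite mcoeff_msupp mcoeffB !mcoeffX eqxx (eq_sym v) (negPf neq_uv) subr0 oner_eq0.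
have sv : v \in msupp ('X_[K, u] - 'X_[v]).
  by rewrite mcoeff_msupp mcoeffB !mcoeffX eqxx (negPf neq_uv) sub0r oppr_eq0 oner_eq0.
have := msize_mdeg_lt su; have := msize_mdeg_lt sv; rewrite /tdeg.
have := msizeD_le 'X_[K, u] (- 'X_[v]); rewrite mmeasureN !mmeasureX.
rewrite maxnSS; case: (msize _) => //= k; rewrite !ltnS => le1 le2 le3.
by apply/eqP; rewrite eqn_leq le1 geq_max le3.
Qed.

(* [max_degree S d] reads "deg_S = d"; there is no such [d] when [S] is empty
   or its degrees are unbounded. *)
Definition max_degree S (d : nat) : Prop :=
  (exists2 f, S f & tdeg f = d) /\ (forall f, S f -> (tdeg f <= d)%N).

Definition binomial : set {mpoly K[m]} :=
  [set f | exists u v, u != v /\ f = 'X_[u] - 'X_[v]].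

Definition mvars f : set 'I_m := [set i | exists2 u, u \in msupp f & u i != 0%N].

Definition monomial_order le : Prop :=
  [/\ reflexive le, antisymmetric le, transitive le & total le] /\
  [/\ forall u, le 0%MM u
    & forall u v w, le u v -> le (u + w)%MM (v + w)%MM].

(* The largest monomial of [f] for [le]; 0 is the least monomial. The library's
   [mlead] is tied to one particular order. *)
Definition lead le f : 'X_{1..m} :=
  \big[(fun u v => if le u v then v else u)/0%MM]_(u <- msupp f) u.

Definition initial_ideal le S : set {mpoly K[m]} :=
  ideal_gen [set 'X_[lead le f] | f in S `\ 0].

Definition groebner_basis le I G : Prop :=
  [set` G] `<=` I /\ initial_ideal le [set` G] = initial_ideal le I.

Definition reduced_groebner_basis le I G : Prop :=
  [/\ groebner_basis le I G,
      forall g, g \in G -> g@_(lead le g) = 1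
    & forall g h, g \in G -> h \in G -> g != h ->
        forall u, u \in msupp h -> ~~ (lead le g <= u)%MM].

End Polynomials.

Section Toric.
Variables (K : fieldType) (n m : nat).
(* The i-th vector of the configuration is [A i]. *)
Variable A : 'I_m -> 'rV[int]_n.

Definition Adegree (u : 'X_{1..m}) : 'rV[int]_n := \sum_(i < m) A i *+ u i.

Definition toric_ideal : set {mpoly K[m]} :=
  ideal_gen [set f | exists u v : 'X_{1..m},
                       Adegree u = Adegree v /\ f = 'X_[u] - 'X_[v]].

Definition graver_basis : set {mpoly K[m]} :=
  [set f | exists u v : 'X_{1..m},
    [/\ f = 'X_[u] - 'X_[v], irreducible f, toric_ideal f
      & forall w z : 'X_{1..m}, w != z -> toric_ideal ('X_[w] - 'X_[z]) ->
          'X_[w] - 'X_[z] != f -> ~~ ((w <= u)%MM && (z <= v)%MM)]].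

Definition universal_groebner_basis : set {mpoly K[m]} :=
  [set f | exists (le : rel 'X_{1..m}) (G : seq {mpoly K[m]}),
    [/\ monomial_order le, reduced_groebner_basis le toric_ideal G & f \in G]].

Definition circuits : set {mpoly K[m]} :=
  [set f | [/\ @binomial K m f, irreducible f, toric_ideal f
    & forall g, binomial g -> toric_ideal g -> ~ mvars g `<` mvars f]].

Definition markov_basis (M : set {mpoly K[m]}) : Prop :=
  [/\ M `<=` @binomial K m, ideal_gen M = toric_ideal
    & forall M', M' `<` M -> ideal_gen M' <> toric_ideal].

End Toric.

Arguments binomial K m _ : clear implicits.
Arguments toric_ideal K {n m} A _.
Arguments graver_basis K {n m} A _.
Arguments universal_groebner_basis K {n m} A _.
Arguments circuits K {n m} A _.

(* Main.v *)
(* The configuration is the incidence matrix of a graph: a complete binary tree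
   of [2 ^ r - 1] edge-disjoint triangles, neighbours in the tree sharing a
   vertex. A lattice vector of its kernel is an integer labelling of the edges of
   the tree. The closed walk through all triangles (label +-1 everywhere) is
   primitive of degree at least [2 ^ r - 2].
   Every lattice vector dominates conformally a walk with labels 0, +-1 which
   branches only at triangles all of whose edges lie in the same monomial
   ("pure nodes"); hence Graver elements, circuits and elements of reduced
   Groebner bases are such walks. If a walk has a pure node, cutting off one
   branch gives a vector of smaller support, so it is not a circuit; the three
   ways to cut off a branch give three elements of the fibre that cannot all lie
   above the leading monomial, so it is not in a reduced Groebner basis either.
   A walk without pure nodes is a path in the tree, of degree at most
   [12 * r + 6]. *)
Require Import Defs.
From mathcomp Require Import all_boot all_order all_algebra.
From mathcomp Require Import boolp classical_sets reals.
From mathcomp Require Import ssrcomplements mpoly.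
From mathcomp Require Import zify.
Import Order.TTheory GRing.Theory Num.Theory.
Set Implicit Arguments.
Unset Strict Implicit.
Unset Printing Implicit Defensive.
Local Open Scope ring_scope.
Local Open Scope classical_set_scope.

(** Parity shapes the argument: for a kernel vector, the two entries of a triangle at a shared
    vertex have an even sum. If all three entries of a triangle are 1, or all are -1, then conformal
    minimality cannot decide against branching, because no part of the triangle can be taken alone.
    This is why Graver elements may branch everywhere and become exponentially large. Circuits and
    reduced Groebner elements obey a further minimality, which also tests vectors that are not
    conformal, such as those with an entry 2 at a pure node. The Markov basis needs no estimate of
    its own: it is chosen inside a reduced Groebner basis and inherits that bound. Constants: a walk
    without pure nodes consists of two arms descending from an apex, so each of the [r] levels of
    the tree carries labels of total absolute value at most 2. The absolute entries of a triangle
    sum to at most three times those of its three labels, and the labels of the children are bounded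
    by that of the node, plus 2 at the apex. This gives [6 * (2 * r) + 6]. *)

Lemma coef_linear1 (R : nzRingType) (a b : R) : (a%:P * 'X - b%:P)`_1 = a.
Proof. by rewrite coefB coefMX !coefC /= subr0. Qed.

Lemma coef_linear0 (R : nzRingType) (a b : R) : (a%:P * 'X - b%:P)`_0 = - b.
Proof. by rewrite coefB coefMX !coefC /= sub0r. Qed.

Lemma size_linear (R : nzRingType) (a b : R) :
  a != 0 -> size (a%:P * 'X - b%:P) = 2%N.
Proof. by move=> a0; rewrite -polyCN size_MXaddC polyC_eq0 (negPf a0) size_polyC a0. Qed.

(** * Generated ideals and minimal generating sets *)

Section IdealGen.
Variable R : comPzRingType.
Implicit Types (S T : set R) (f g : R).

Lemma ideal_gen_sub S : S `<=` ideal_gen S.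
Proof.
by move=> f Sf; exists 1%N, (fun=> 1), (fun=> f); rewrite big_ord1 mul1r.
Qed.

Lemma ideal_gen0 S : ideal_gen S 0.
Proof. by exists 0%N, (fun=> 0), (fun=> 0); split; [case|rewrite big_ord0]. Qed.

Lemma ideal_genMl S c f : ideal_gen S f -> ideal_gen S (c * f).
Proof.
move=> [k [d [g [Sg ->]]]]; exists k, (fun i => c * d i), g; split=> //.
by rewrite mulr_sumr; apply: eq_bigr => i _; rewrite mulrA.
Qed.

Lemma ideal_genD S f g : ideal_gen S f -> ideal_gen S g -> ideal_gen S (f + g).
Proof.
move=> [k [c [a [Sa ->]]]] [l [d [b [Sb ->]]]].
exists (k + l)%N, (fun i => match split i with inl j => c j | inr j => d j end),
  (fun i => match split i with inl j => a j | inr j => b j end); split.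
  by move=> i; case: (split i).
rewrite big_split_ord /=; congr (_ + _); apply: eq_bigr => i _.
  by rewrite -[lshift _ _]/(unsplit (inl i)) unsplitK.
by rewrite -[rshift _ _]/(unsplit (inr i)) unsplitK.
Qed.

Lemma ideal_gen_min S T : S `<=` ideal_gen T -> ideal_gen S `<=` ideal_gen T.
Proof.
move=> sST _ [k [c [g [Sg ->]]]].
apply: (big_ind (ideal_gen T)); [exact: ideal_gen0|exact: ideal_genD|].
by move=> i _; apply/ideal_genMl/sST.
Qed.

Lemma eq_ideal_gen S T :
  S `<=` ideal_gen T -> T `<=` ideal_gen S -> ideal_gen S = ideal_gen T.
Proof. by move=> sST sTS; apply/seteqP; split; apply: ideal_gen_min. Qed.

Lemma ideal_gen_set0 : ideal_gen set0 `<=` [set (0 : R)].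
Proof.
by move=> _ [[|k] [c [g [Sg ->]]]] /=; [rewrite big_ord0|case: (Sg ord0)].
Qed.

(** Descent on the length of the list: a proper subset with the same span is again given by a
    shorter list. Keeping [M] inside [s] is what carries degree bounds over to the Markov basis. *)
Lemma minimal_generators (s : seq R) :
  exists M : set R, [/\ M `<=` [set` s], ideal_gen M = ideal_gen [set` s]
    & forall M', M' `<` M -> ideal_gen M' <> ideal_gen [set` s]].
Proof.
have [n] := ubnP (size s); elim: n => // n IHn in s *; rewrite ltnS => le_s_n.
have [[M' [[sM' neM'] eqM']]|noM] := pselect
    (exists M', M' `<` [set` s] /\ ideal_gen M' = ideal_gen [set` s]); last first.
  by exists [set` s]; split=> // M' ltM' eqM'; apply: noM; exists M'.
pose s' := [seq x <- s | `[< M' x >]].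
have eqs' : [set` s'] = M'.
  apply/seteqP; split=> x /=; rewrite mem_filter.
    by case/andP=> /asboolP.
  by move=> Mx; rewrite (asboolT Mx) /=; apply: sM'.
have lt_s' : (size s' < n)%N.
  apply: leq_trans le_s_n; rewrite ltn_neqAle size_filter count_size andbT.
  rewrite -all_count; apply: contra_notN neM' => /allP allM x /= xs.
  exact/asboolP/allM.
have [M [sM eqM minM]] := IHn _ lt_s'; exists M; split.
- by apply: subset_trans sM _; rewrite eqs'.
- by rewrite eqM eqs'.
- by move=> M'' /minM; rewrite eqs' eqM'.
Qed.

End IdealGen.

Lemma max_degree_exists (K : fieldType) m (S : set {mpoly K[m]}) B :
  S !=set0 -> (forall f, S f -> (tdeg f <= B)%N) ->
  exists2 d, max_degree S d & (d <= B)%N.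
Proof.
move=> [f0 Sf0] leB.
pose P d := `[< exists2 f, S f & tdeg f = d >].
have exP : exists d, P d by exists (tdeg f0); apply/asboolP; exists f0.
have ubP d : P d -> (d <= B)%N by case/asboolP=> f Sf <-; apply: leB.
exists (ex_maxn exP ubP); case: ex_maxnP => d Pd maxd; last exact: ubP.
split; first exact/asboolP.
by move=> f Sf; apply: maxd; apply/asboolP; exists f.
Qed.

(** * Binomials: supports, divisors and irreducibility *)

Section Monomials.
Variables (K : fieldType) (m : nat).
Implicit Types (u v w : 'X_{1..m}) (f g : {mpoly K[m]}).

Lemma msupp_binomial u v : u != v -> msupp ('X_[K, u] - 'X_[v]) =i [:: u; v].
Proof.
move=> neq_uv w; rewrite mcoeff_msupp mcoeffB !mcoeffX !inE ![_ == w]eq_sym.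
case: (eqVneq w u) => [->|_]; first by rewrite (negPf neq_uv) subr0 oner_eq0.
by rewrite sub0r oppr_eq0; case: (w == v); rewrite ?oner_eq0 ?eqxx.
Qed.

Lemma binomial_neq0 u v : u != v -> 'X_[u] - 'X_[v] != 0 :> {mpoly K[m]}.
Proof.
move=> neq_uv; apply/eqP => eq0; have := msupp_binomial neq_uv u.
by rewrite eq0 -[0]/(0%:MP) msupp0 !inE eqxx.
Qed.

Lemma mvars_binomial u v : u != v ->
  mvars ('X_[K, u] - 'X_[v]) = [set i | (u i != 0%N) || (v i != 0%N)].
Proof.
move=> neq_uv; apply/seteqP; split=> i /=.
  by case=> w; rewrite msupp_binomial // !inE => /orP[] /eqP-> ->; rewrite ?orbT.
by case/orP=> ?; [exists u|exists v]; rewrite // msupp_binomial // !inE eqxx ?orbT.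
Qed.

Lemma unit_msupp f w : f \is a GRing.unit -> w \in msupp f -> w = 0%MM.
Proof.
rewrite unfold_in => /andP[/eqP-> _].
by rewrite mcoeff_msupp mcoeffC; have [//|_] := eqVneq w 0%MM; rewrite mulr0 eqxx.
Qed.

Lemma binomial_nonunit u v : u != v -> 'X_[K, u] - 'X_[v] \isn't a GRing.unit.
Proof.
move=> neq_uv; apply/negP => Uf; have sf := msupp_binomial neq_uv.
have u0 : u = 0%MM by apply: (unit_msupp Uf); rewrite sf !inE eqxx.
have v0 : v = 0%MM by apply: (unit_msupp Uf); rewrite sf !inE eqxx orbT.
by rewrite u0 v0 eqxx in neq_uv.
Qed.


Lemma monomial_ideal_divisor (L : set 'X_{1..m}) f w :
  ideal_gen [set 'X_[l] | l in L] f -> w \in msupp f ->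
  exists2 l, L l & (l <= w)%MM.
Proof.
move=> [k [c [g [Sg ->]]]] /msupp_sum_le /flattenP[s /mapP[i _ ->]].
case: (Sg i) => l Ll <-; rewrite (perm_mem (msuppMX _ _)) => /mapP[w' _ ->].
by exists l => //; apply: lem_addr.
Qed.

(* [f] as a polynomial in the single variable [i], over the ring of the others. *)
Definition in_var (i : 'I_m) : {mpoly K[m]} -> {poly {mpoly K[m]}} :=
  mmap (polyC \o @mpolyC m K) (fun j => if j == i then 'X else ('X_j)%:P).

Section InVar.
Variable i : 'I_m.

Lemma in_varM f g : in_var i (f * g) = in_var i f * in_var i g.
Proof. exact: rmorphM. Qed.

Lemma in_varB f g : in_var i (f - g) = in_var i f - in_var i g.
Proof. exact: rmorphB. Qed.

Lemma in_varX u : in_var i 'X_[u] = ('X_[u - U_(i) *+ u i])%:P * 'X ^+ u i.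
Proof.
rewrite /in_var mmapX /mmap1 (bigD1 i) //= eqxx mulrC; congr (_ * _).
rewrite mpolyXE_id rmorph_prod /= [RHS](bigD1 i) //=.
rewrite mnmBE mulmnE mnm1E eqxx mul1n subnn expr0 rmorph1 mul1r.
apply: eq_bigr => j neq_ji; rewrite (negPf neq_ji) rmorphXn mnmBE mulmnE mnm1E.
by rewrite eq_sym (negPf neq_ji) mul0n subn0.
Qed.

Lemma horner_in_var f : (in_var i f).['X_i] = f.
Proof.
rewrite {2}[f]mpolyE /in_var /mmap horner_sum; apply: eq_bigr => u _.
rewrite -mul_mpolyC hornerM /= hornerC; congr (_ * _).
rewrite [RHS]mpolyXE_id /mmap1 horner_prod; apply: eq_bigr => j _.
by rewrite horner_exp; case: eqP => [->|_]; rewrite ?hornerX ?hornerC.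
Qed.

Lemma in_var_neq0 f : f != 0 -> in_var i f != 0.
Proof. by apply: contra_neq => f0; rewrite -(horner_in_var f) f0 horner0. Qed.

Lemma in_var_size1 f : (size (in_var i f) <= 1)%N -> in_var i f = f%:P.
Proof. by move/size1_polyC=> e; rewrite -[f in RHS]horner_in_var e hornerC. Qed.

Lemma in_var_const f w : (size (in_var i f) <= 1)%N -> w \in msupp f -> w i = 0%N.
Proof.
move/in_var_size1 => /(congr1 (fun q => q.[0])); rewrite hornerC => <-.
rewrite {1}/in_var /mmap horner_sum => /msupp_sum_le /flattenP[s /mapP[u _ ->]].
rewrite hornerM /= hornerC mul_mpolyC -[mmap1 _ _](@mmapX _ _ _ _ (polyC \o @mpolyC m K)).
rewrite -/(in_var i _) in_varX hornerM hornerC horner_exp hornerX expr0n.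
case: eqP => [u0|_]; last by rewrite mulr0 scaler0 -[0]/(0%:MP) msupp0.
rewrite mulr1 => /msuppZ_le; rewrite msuppX inE => /eqP->.
by rewrite mnmBE mulmnE mnm1E eqxx mul1n subnn.
Qed.

End InVar.

Lemma divisor_of_monomial i f g u :
  f * g = 'X_[u] \/ f * g = - 'X_[u] -> u i = 0%N -> (size (in_var i f) <= 1)%N.
Proof.
move=> fgX ui0.
have fg_neq0 : f * g != 0 by case: fgX => ->; rewrite ?oppr_eq0 -msize_poly_eq0 msizeX.
have /norP[f0 g0] : ~~ ((f == 0) || (g == 0)) by rewrite -mulf_eq0.
have : (size (in_var i (f * g)) <= 1)%N.
  have le1 : (size (in_var i 'X_[u]) <= 1)%N.
    by rewrite in_varX ui0 expr0 mulr1 size_polyC leq_b1.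
  by case: fgX => ->; rewrite ?[in_var i (- _)]rmorphN ?size_polyN.
rewrite in_varM size_mul ?in_var_neq0 //.
have arith a b : (0 < b -> (a + b).-1 <= 1 -> a <= 1)%N by lia.
by apply: arith; rewrite size_poly_gt0 in_var_neq0.
Qed.

(** The binomial has degree 1 in variable [i], so one of two factors is free of it. That factor
    divides both coefficients, which are coprime monomials up to sign: every variable is missing
    from one of them, hence from the factor, which is therefore constant. *)
Lemma irreducible_binomial u v i :
  (forall j, (u j == 0%N) || (v j == 0%N)) -> (u i = 1%N \/ v i = 1%N) ->
  irreducible ('X_[K, u] - 'X_[v]).
Proof.
wlog ui : u v / u i = 1%N.
  move=> W disj [ui|vi]; first by apply: W => //; left.
  have disj' j : (v j == 0%N) || (u j == 0%N) by rewrite orbC.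
  have [nz nu irr] := W v u vi disj' (or_introl vi).
  rewrite -opprB; split; first by rewrite oppr_eq0.
    by rewrite unitrN.
  move=> y z /eqP; rewrite eqr_oppLR -mulNr => /eqP /irr.
  by rewrite unitrN.
move=> disj _; have vi : v i = 0%N by case/orP: (disj i); rewrite ?ui // => /eqP.
have neq_uv : u != v by apply: contra_eqN ui => /eqP->; rewrite vi.
split; [exact: binomial_neq0|exact: binomial_nonunit|].
have expand : in_var i ('X_[K, u] - 'X_[v]) =
      ('X_[u - U_(i)])%:P * 'X - ('X_[v])%:P.
  rewrite in_varB !in_varX ui vi /=.
  by rewrite mulm1n mulm0n subm0 expr1 expr0 mulr1.
have main y z : 'X_[K, u] - 'X_[v] = y * z ->
    (size (in_var i z) <= 1)%N -> z \is a GRing.unit.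
  move=> eq_yz sz1.
  have /in_var_size1 zC := sz1.
  have eqc k : (in_var i y)`_k * z = (in_var i ('X_[K, u] - 'X_[v]))`_k.
    by rewrite eq_yz in_varM zC coefMC.
  have zU : z * (in_var i y)`_1 = 'X_[u - U_(i)].
    by rewrite [LHS]mulrC (eqc 1%N) expand; apply: coef_linear1.
  have zV : z * (in_var i y)`_0 = - 'X_[v].
    by rewrite [LHS]mulrC (eqc 0%N) expand; apply: coef_linear0.
  have z0 : z != 0.
    by apply: contraNneq (binomial_neq0 neq_uv) => z0; rewrite eq_yz z0 mulr0.
  have const_z w : w \in msupp z -> w = 0%MM.
    move=> sw; apply/mnmP => j; rewrite mnm0E; apply: in_var_const sw.
    case/orP: (disj j) => [/eqP uj|/eqP vj]; last first.
      by apply: divisor_of_monomial (or_intror zV) _.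
    apply: divisor_of_monomial (or_introl zU) _.
    by rewrite mnmBE uj.
  have zE : z = (z@_0)%:MP.
    apply/mpolyP => w; rewrite mcoeffC; case: eqP => [->|/eqP w0]; first by rewrite mulr1.
    rewrite mulr0; apply: memN_msupp_eq0; apply: contra w0.
    by move/const_z ->.
  rewrite unfold_in /mpoly_unit; apply/andP; split; first exact/eqP.
  by rewrite unitfE; apply: contraNneq z0 => z00; rewrite zE z00 mpolyC0.
move=> y z eq_yz.
have : size (in_var i (y * z)) = 2%N.
  rewrite -eq_yz expand; apply: size_linear.
  by rewrite -msize_poly_eq0 msizeX.
have yz0 : y * z != 0 by rewrite -eq_yz binomial_neq0.
have /norP[y0 z0] : ~~ ((y == 0) || (z == 0)) by rewrite -mulf_eq0.
have sy : (0 < size (in_var i y))%N by rewrite size_poly_gt0 in_var_neq0.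
have sz : (0 < size (in_var i z))%N by rewrite size_poly_gt0 in_var_neq0.
rewrite in_varM size_mul ?in_var_neq0 // => eq2.
have [le1|gt1] := leqP (size (in_var i z)) 1; first by right; apply: main eq_yz le1.
left; apply: (main z); first by rewrite mulrC.
have arith a b : (0 < a -> 0 < b -> (a + b).-1 = 2 -> 1 < b -> a <= 1)%N by lia.
exact: arith sy sz eq2 gt1.
Qed.

Lemma irreducible_disjoint u v : irreducible ('X_[K, u] - 'X_[v]) ->
  forall i, (u i == 0%N) || (v i == 0%N).
Proof.
move=> [nz _ irr] i; apply/norP => -[ui vi].
have neq_uv : u != v by apply: contraNneq nz => ->; rewrite subrr.
have le_u : (U_(i) <= u)%MM by rewrite lep1mP.
have le_v : (U_(i) <= v)%MM by rewrite lep1mP.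
have [|Ui|Ud] := irr 'X_i ('X_[u - U_(i)] - 'X_[v - U_(i)]).
- by rewrite mulrBr -!mpolyXD ![(U_(i) + _)%MM]addmC !submK.
- have /eqP : U_(i)%MM = 0%MM by apply: (unit_msupp Ui); rewrite msuppX inE.
  by rewrite mnm1_eq0.
move: Ud; apply/negP/binomial_nonunit; apply: contra neq_uv => /eqP e.
by rewrite -(submK le_u) -(submK le_v) e.
Qed.

(** A difference of [l]-th powers is divisible by the difference of the bases; irreducibility makes
    the cofactor a unit, and comparing degrees leaves only [l = 1]. *)
Lemma irreducible_binomial_exponent u v l : u != v ->
  irreducible ('X_[K, u *+ l] - 'X_[v *+ l]) -> l = 1%N.
Proof.
move=> neq_uv [nz _ irr].
have l0 : l != 0%N by apply: contraNneq nz => ->; rewrite !mulm0n subrr.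
have neq_l : (u *+ l != v *+ l)%MM by apply: contraNneq nz => ->; rewrite subrr.
have nu := binomial_nonunit neq_uv.
pose q := \sum_(i < l) 'X_[K, u] ^+ (l.-1 - i) * 'X_[v] ^+ i.
have eq_q : 'X_[u *+ l] - 'X_[v *+ l] = ('X_[u] - 'X_[v]) * q.
  by rewrite -!mpolyXn subrXX.
have [|Uq] := irr _ _ eq_q; first by rewrite (negPf nu).
have := tdeg_binomial K neq_l; rewrite !mdegMn eq_q /tdeg.
move: Uq; rewrite unfold_in => /andP[/eqP qC].
rewrite unitfE => q0; rewrite qC mulrC mul_mpolyC msizeZ //.
rewrite -/(tdeg ('X_[u] - 'X_[v])) tdeg_binomial //.
rewrite -maxnMl -[in LHS](muln1 (maxn _ _)) => /eqP; rewrite eqn_pmul2l => [/eqP//|].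
rewrite lt0n; apply: contra neq_uv; rewrite -leqn0 geq_max !leqn0 !mdeg_eq0.
by case/andP=> /eqP-> /eqP->.
Qed.

End Monomials.

(** * Toric ideals: fibres, standard monomials, reduced Groebner bases *)

Section Toric.
Variables (K : fieldType) (n m : nat) (A : 'I_m -> 'rV[int]_n).
Implicit Types (u v w z : 'X_{1..m}) (f g : {mpoly K[m]}).
Local Notation Adeg := (Adegree A).
Local Notation I := (toric_ideal K A).

Lemma AdegreeD u v : Adeg (u + v)%MM = Adeg u + Adeg v.
Proof. by rewrite -big_split; apply: eq_bigr => i _; rewrite mnmDE mulrnDr. Qed.

Lemma toric_binomial u v : Adeg u = Adeg v -> I ('X_[u] - 'X_[v]).
Proof. by move=> eq_uv; apply: ideal_gen_sub; exists u, v. Qed.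

(** An additive functional that vanishes on the toric ideal; hence no element of the ideal meets a
    fibre in exactly one monomial. *)
Definition fiber_sum (b : 'rV[int]_n) f : K :=
  \sum_(w <- msupp f) if Adeg w == b then f@_w else 0.

Lemma fiber_sumwE b f k : (msize f <= k)%N ->
  fiber_sum b f = \sum_(w : 'X_{1..m < k}) if Adeg w == b then f@_w else 0.
Proof.
move=> le_fk; pose J : subFinType _ := 'X_{1..m < k}.
rewrite /fiber_sum (big_mksub J) ?msupp_uniq //=; first last.
  by move=> x /msize_mdeg_lt /leq_trans; apply.
rewrite big_rmcond //= => j /memN_msupp_eq0 ->.
by case: ifP.
Qed.

Lemma fiber_sumD b f g : fiber_sum b (f + g) = fiber_sum b f + fiber_sum b g.
Proof.
pose k := maxn (msize (f + g)) (maxn (msize f) (msize g)).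
rewrite !(@fiber_sumwE b _ k) /k ?leq_max ?leqnn ?orbT // -big_split.
by apply: eq_bigr => w _ /=; case: ifP; rewrite ?mcoeffD ?addr0.
Qed.

Lemma fiber_sumN b f : fiber_sum b (- f) = - fiber_sum b f.
Proof.
rewrite /fiber_sum (perm_big _ (msuppN f)) -sumrN.
by apply: eq_bigr => w _; case: ifP; rewrite ?mcoeffN ?oppr0.
Qed.

Lemma fiber_sum_toric b f : I f -> fiber_sum b f = 0.
Proof.
move=> [k [c [g [Sg ->]]]]; elim/big_ind: _ => [|x y x0 y0|i _].
- by apply: (addrI (fiber_sum b 0)); rewrite -fiber_sumD !addr0.
- by rewrite fiber_sumD x0 y0 addr0.
have [u [v [eq_uv ->]]] := Sg i.
have fsX w : fiber_sum b (c i * 'X_[w]) =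
    \sum_(x <- msupp (c i)) if Adeg w + Adeg x == b then (c i)@_x else 0.
  rewrite /fiber_sum (perm_big _ (msuppMX _ _)) big_map.
  by apply: eq_bigr => x _; rewrite AdegreeD mcoeffMX.
by rewrite mulrBr fiber_sumD fiber_sumN !fsX eq_uv subrr.
Qed.

Lemma toric_ideal_fiber f w : I f -> w \in msupp f ->
  exists2 w', w' \in msupp f & w' != w /\ Adeg w' = Adeg w.
Proof.
move=> If sw; have := fiber_sum_toric (Adeg w) If.
rewrite /fiber_sum (bigD1_seq w) //= eqxx => sum0.
have [/hasP[w' sw' /andP[? /eqP ?]]|/hasPn no] := boolP
  (has (fun x => (x != w) && (Adeg x == Adeg w)) (msupp f)); first by exists w'.
move: sum0; rewrite big_seq_cond big1 ?addr0; last first.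
  by move=> x /andP[/no]; case: (x == w) => //= /negPf->.
by move/eqP; rewrite mcoeff_eq0 sw.
Qed.

Lemma toric_binomialP u v : I ('X_[u] - 'X_[v]) <-> Adeg u = Adeg v.
Proof.
split=> [Iuv|]; last exact: toric_binomial.
have [->//|neq_uv] := eqVneq u v.
have [|w] := @toric_ideal_fiber _ u Iuv; first by rewrite msupp_binomial // !inE eqxx.
by rewrite msupp_binomial // !inE => /orP[/eqP->|/eqP-> [_ ->]] //; rewrite eqxx => -[].
Qed.

Section MonomialOrder.
Variable le : rel 'X_{1..m}.
Hypothesis mo_le : monomial_order le.

Let le_refl : reflexive le. Proof. by case: mo_le => -[]. Qed.
Let le_anti : antisymmetric le. Proof. by case: mo_le => -[]. Qed.
Let le_trans : transitive le. Proof. by case: mo_le => -[]. Qed.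
Let le_total : total le. Proof. by case: mo_le => -[]. Qed.
Let le_0 u : le 0%MM u. Proof. by case: mo_le => _ []. Qed.
Let le_D w u v : le u v -> le (u + w)%MM (v + w)%MM.
Proof. by case: mo_le => _ [_]; apply. Qed.

Lemma order_cancel w u v : le (u + w)%MM (v + w)%MM -> le u v.
Proof.
move=> le_uvw; case/orP: (le_total u v) => // /(@le_D w) le_vuw.
by have /addIm-> : (u + w = v + w)%MM by apply: le_anti; rewrite le_uvw.
Qed.

Lemma order_add u v w z : le u v -> le w z -> le (u + w)%MM (v + z)%MM.
Proof.
move=> le_uv le_wz; apply: le_trans (le_D w le_uv) _.
by rewrite ![(v + _)%MM]addmC; apply: le_D.
Qed.

Lemma order_divides u v : (u <= v)%MM -> le u v.
Proof. by move/submK <-; rewrite -{1}[u]add0m; apply: le_D. Qed.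

Lemma order_min (s : seq 'X_{1..m}) x : x \in s ->
  exists2 y, y \in s & forall z, z \in s -> le y z.
Proof.
elim: s x => // a s IHs x _.
have [[y]|no] := pselect (exists y, y \in s); last first.
  exists a; rewrite ?mem_head // => z; rewrite inE => /orP[/eqP->//|sz].
  by case: no; exists z.
case/IHs => b sb minb; case/orP: (le_total a b) => leab.
  exists a; rewrite ?mem_head // => z; rewrite inE => /orP[/eqP->//|/minb].
  exact: le_trans.
exists b; first by rewrite inE sb orbT.
by move=> z; rewrite inE => /orP[/eqP->//|/minb].
Qed.

Lemma leadP f : f != 0 ->
  lead le f \in msupp f /\ forall w, w \in msupp f -> le w (lead le f).
Proof.
rewrite -msupp_eq0.
pose mx (s : seq _) := \big[(fun u v => if le u v then v else u)/0%MM]_(u <- s) u.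
have mx_cons a s : mx (a :: s) = if le a (mx s) then mx s else a.
  by rewrite /mx big_cons.
rewrite -[lead le f]/(mx (msupp f)); elim: (msupp f) => // a s IHs _.
have [->|s0] := eqVneq s [::].
  have -> : mx [:: a] = a.
    rewrite mx_cons /mx big_nil; case: ifP => // lea0.
    by apply: le_anti; rewrite lea0 le_0.
  by split=> [|w]; rewrite inE // => /eqP->.
have [sb maxb] := IHs s0; rewrite mx_cons; case: ifPn => [leab|nleab].
  by split=> [|w]; rewrite inE ?sb ?orbT // => /orP[/eqP->|/maxb].
have leba : le (mx s) a by case/orP: (le_total a (mx s)) nleab => [->|].
split=> [|w]; rewrite inE ?eqxx // => /orP[/eqP->//|/maxb lew].
exact: le_trans lew leba.
Qed.

Lemma lead_binomial u v : u != v -> le v u -> lead le ('X_[K, u] - 'X_[v]) = u.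
Proof.
move=> neq_uv le_vu; have [] := leadP (binomial_neq0 K neq_uv).
rewrite msupp_binomial // !inE => /orP[/eqP//|/eqP-> maxl].
apply: le_anti; rewrite le_vu; apply: maxl.
by rewrite msupp_binomial // mem_head.
Qed.

(* The standard monomials of the initial ideal; there is one in each fibre. *)
Definition standard u : Prop := forall v, Adeg v = Adeg u -> le u v.

Lemma standard_uniq u v : standard u -> standard v -> Adeg u = Adeg v -> u = v.
Proof. by move=> su sv eq_uv; apply: le_anti; rewrite su ?sv. Qed.

Lemma standard_divides u v : (u <= v)%MM -> standard v -> standard u.
Proof.
move=> le_uv sv w eq_wu; apply: (@order_cancel (v - u)%MM).
by rewrite addmC submK // addmC sv // -[in RHS](submK le_uv) !AdegreeD eq_wu.
Qed.

Lemma lead_not_standard f : I f -> f != 0 -> ~ standard (lead le f).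
Proof.
move=> If f0; have [sl maxl] := leadP f0.
have [w sw [neq_w eq_w]] := toric_ideal_fiber If sl.
move=> /(_ _ eq_w) le_lw; case/eqP: neq_w.
by apply: le_anti; rewrite le_lw maxl.
Qed.

(** The minimal monomial generators of the initial ideal, expressed through fibres so that no
    Groebner basis is needed to speak of them. *)
Definition minimal_nonstandard u : Prop :=
  ~ standard u /\ forall d, (d <= u)%MM -> d != u -> standard d.

Lemma minimal_nonstandard_divisor u : ~ standard u ->
  exists2 d, (d <= u)%MM & minimal_nonstandard d.
Proof.
have [k] := ubnP (mdeg u); elim: k => // k IHk in u *; rewrite ltnS => le_uk nsu.
have [[d [le_du neq_du nsd]]|no] :=
    pselect (exists d, [/\ (d <= u)%MM, d != u & ~ standard d]); last first.
  exists u; first exact: lepm_refl.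
  by split=> // d le_du neq_du; apply: contrapT => nsd; apply: no; exists d.
have lt_du : (mdeg d < k)%N.
  apply: leq_trans le_uk; rewrite -[u in leqRHS](submK le_du) mdegD.
  rewrite -[ltnLHS]add0n ltn_add2r lt0n mdeg_eq0; apply: contra neq_du => /eqP e.
  by rewrite -[u](submK le_du) e add0m.
have [e le_ed mine] := IHk _ lt_du nsd; exists e => //.
exact: lepm_trans le_ed le_du.
Qed.

Section Pair.
Variables u v : 'X_{1..m}.
Hypotheses (minu : minimal_nonstandard u) (sv : standard v) (eq_uv : Adeg u = Adeg v).

Lemma pair_neq : u != v.
Proof. by apply/eqP => e; case: minu; rewrite e. Qed.

(** A fibre has only one standard monomial. Here [z] is standard as a divisor of [v], and so is [w]
    unless it is all of [u]. *)
Lemma pair_primitive w z : (w <= u)%MM -> (z <= v)%MM -> Adeg w = Adeg z ->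
  w != z -> w = u /\ z = v.
Proof.
move=> le_wu le_zv eq_wz neq_wz; have sz := standard_divides le_zv sv.
have [ewu|neq_wu] := eqVneq w u.
  by split=> //; apply: standard_uniq; rewrite // -eq_wz ewu.
by case/eqP: neq_wz; apply: standard_uniq => //; apply: (minu.2).
Qed.

Lemma pair_disjoint i : (u i == 0%N) || (v i == 0%N).
Proof.
apply/norP => -[ui vi].
have le_u : (U_(i) <= u)%MM by rewrite lep1mP.
have le_v : (U_(i) <= v)%MM by rewrite lep1mP.
case/eqP: pair_neq; rewrite -(submK le_u) -(submK le_v); congr (_ + _)%MM.
apply: standard_uniq.
- apply: (minu.2); first exact: lem_subr.
  by apply: contraNneq ui => /mnmP/(_ i); rewrite mnmBE mnm1E eqxx; lia.
- by apply: standard_divides sv; apply: lem_subr.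
apply: (addIr (Adeg U_(i)%MM)); rewrite -!AdegreeD !submK //.
Qed.

(** Dividing [u] by the shared variable gives a proper divisor, which is standard and so lies below
    the quotient of [w]. This is the only information about the order used against pure nodes, apart
    from [v] being standard. *)
Lemma pair_order i w : Adeg w = Adeg u -> u i != 0%N -> w i != 0%N -> le u w.
Proof.
move=> eq_wu ui wi.
have le_u : (U_(i) <= u)%MM by rewrite lep1mP.
have le_w : (U_(i) <= w)%MM by rewrite lep1mP.
rewrite -(submK le_u) -(submK le_w); apply: le_D.
have: standard (u - U_(i))%MM.
  apply: (minu.2); first exact: lem_subr.
  by apply: contraNneq ui => /mnmP/(_ i); rewrite mnmBE mnm1E eqxx; lia.
apply; apply: (addIr (Adeg U_(i)%MM)); rewrite -!AdegreeD !submK //.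
Qed.

End Pair.

Lemma nonstandard_lead G u : groebner_basis le I G -> ~ standard u ->
  exists2 h, h \in G & (lead le h <= u)%MM.
Proof.
move=> [_ eq_in] nsu.
have [v [eq_vu nle]] : exists v, Adeg v = Adeg u /\ ~~ le u v.
  apply: contrapT => no; apply: nsu => v eq_vu; apply: contrapT => /negP nle.
  by apply: no; exists v.
have neq_uv : u != v by apply: contraNneq nle => ->.
have le_vu : le v u by case/orP: (le_total u v) nle => [->|].
have : initial_ideal le I ('X_[K, u]).
  apply: ideal_gen_sub; exists ('X_[u] - 'X_[v]); last by rewrite lead_binomial.
  by split; [apply: toric_binomial|apply/eqP/binomial_neq0].
rewrite -eq_in /initial_ideal => Iu.
have [l [h [Gh _] <-] le_lu] : exists2 l, [set lead le h | h in [set` G] `\ 0] l & (l <= u)%MM.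
  apply: monomial_ideal_divisor (_ : u \in msupp 'X_[K, u]); last first.
    by rewrite msuppX inE.
  apply: ideal_gen_min Iu => _ [h Gh <-]; apply: ideal_gen_sub.
  by exists (lead le h) => //; exists h.
by exists h.
Qed.

(** Reducedness makes every monomial of [g] except the leading one standard. Each monomial has a
    companion of equal [A]-degree in the support, while a fibre has one standard monomial; so only
    one tail monomial can occur. *)
Lemma reduced_groebner_pair G g : reduced_groebner_basis le I G -> g \in G ->
  exists u v, [/\ minimal_nonstandard u, standard v, Adeg u = Adeg v
    & g = 'X_[u] - 'X_[v]].
Proof.
move=> [gbG monicG redG] Gg; have [sGI _] := gbG.
have g0 : g != 0.
  by apply: contraTneq (oner_neq0 K) => g0; rewrite -(monicG g Gg) g0 mcoeff0 eqxx.
have Ig : I g by apply: sGI.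
have [su maxu] := leadP g0; set u := lead le g in su maxu.
have stdg w : w \in msupp g -> w != u -> standard w.
  move=> sw neq_wu; apply: contrapT => /(nonstandard_lead gbG)[h Gh le_hw].
  have [ehg|neq_hg] := eqVneq h g; last by have := redG _ _ Gh Gg neq_hg _ sw; rewrite le_hw.
  by case/eqP: neq_wu; apply: le_anti; rewrite maxu //= order_divides // /u -ehg.
have minu : minimal_nonstandard u.
  split=> [|d le_du neq_du]; first exact: lead_not_standard.
  apply: contrapT => /(nonstandard_lead gbG)[h Gh le_hd].
  have [ehg|neq_hg] := eqVneq h g.
    by case/eqP: neq_du; apply: le_anti; rewrite !order_divides // /u -ehg.
  by have := redG _ _ Gh Gg neq_hg _ su; rewrite (lepm_trans le_hd).
have [v sv [neq_vu eq_vu]] := toric_ideal_fiber Ig su.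
have stdv := stdg v sv neq_vu.
exists u, v; split=> //.
have small w : w \in msupp g -> w = u \/ w = v.
  move=> sw; have [|neq_wu] := eqVneq w u; [by left|right].
  have stdw := stdg w sw neq_wu.
  have [w' sw' [neq_w' eq_w']] := toric_ideal_fiber Ig sw.
  have [e|neq_w'u] := eqVneq w' u.
    by apply: standard_uniq; rewrite // -eq_w' e eq_vu.
  by case/eqP: neq_w'; apply: standard_uniq => //; apply: stdg.
have gu : g@_u = 1 by apply: monicG.
(* The difference [f] is an element of the ideal supported on [v] alone, so it must vanish. *)
apply/eqP; rewrite -subr_eq0; apply/negPn/negP => f0.
set f := (X in X != 0) in f0; have If : I f.
  by apply: ideal_genD => //; rewrite -mulN1r; apply/ideal_genMl/toric_binomial.
have suppf w : w \in msupp f -> w = v.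
  rewrite mcoeff_msupp !mcoeffB !mcoeffX; have [<-|wu] := eqVneq u w.
    by rewrite gu (negPf neq_vu) subr0 subrr eqxx.
  have [//|wv] := eqVneq v w; rewrite !subr0 -mcoeff_msupp => /small[] e.
    by rewrite e eqxx in wu.
  by rewrite e eqxx in wv.
have [sl _] := leadP f0; have [w /suppf ew [neq_w _]] := toric_ideal_fiber If sl.
by rewrite ew (suppf _ sl) eqxx in neq_w.
Qed.

Section Existence.
Hypothesis graded : forall u v, Adeg u = Adeg v -> mdeg u = mdeg v.

(** Fibres are finite by the grading, so minima exist without well-foundedness of [le]. *)
Lemma fiber_min (P : set 'X_{1..m}) u : P u ->
  exists v, [/\ P v, Adeg v = Adeg u
    & forall w, P w -> Adeg w = Adeg u -> le v w].
Proof.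
move=> Pu; pose Q w := `[< P w >] && (Adeg w == Adeg u).
pose s := [seq val w | w : 'X_{1..m < (mdeg u).+1} <- enum {: 'X_{1..m < (mdeg u).+1}} & Q (val w)].
have memP w : (w \in s) = Q w.
  apply/mapP/idP => [[x]|Qw]; first by rewrite mem_filter => /andP[? _] ->.
  have lt_w : (mdeg w < (mdeg u).+1)%N.
    by case/andP: Qw => _ /eqP/graded ->.
  by exists (BMultinom lt_w); rewrite // mem_filter mem_enum andbT.
have [|v] := @order_min s u; first by rewrite memP /Q eqxx andbT; apply/asboolP.
rewrite memP => /andP[/asboolP Pv /eqP eq_vu] minv; exists v; split=> // w Pw eq_wu.
by apply: minv; rewrite memP /Q eq_wu eqxx andbT; apply/asboolP.
Qed.

(** The bound [B] makes the minimal nonstandard monomials finite in number and thus takes the place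
    of Dickson's lemma. The basis consists of these monomials minus their normal forms. *)
Lemma reduced_groebner_exists B :
  (forall u v, minimal_nonstandard u -> standard v -> Adeg u = Adeg v ->
    (mdeg u <= B)%N) ->
  exists2 G, reduced_groebner_basis le I G & ideal_gen [set` G] = I.
Proof.
move=> bound.
have exnf u : exists v, standard v /\ Adeg v = Adeg u.
  have [v [_ eq_vu minv]] := @fiber_min setT u Logic.I.
  by exists v; split=> // w eq_wv; apply: minv; rewrite // eq_wv.
have /choice[nf nfP] := exnf.
have nf_std u : standard (nf u) by have [] := nfP u.
have nf_deg u : Adeg (nf u) = Adeg u by have [] := nfP u.
pose Q u := `[< minimal_nonstandard u >].
pose G := [seq 'X_[val u] - 'X_[nf (val u)] : {mpoly K[m]}
          | u : 'X_{1..m < B.+1} <- enum {: 'X_{1..m < B.+1}} & Q (val u)].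
have GP g : g \in G <-> exists2 u, minimal_nonstandard u & g = 'X_[u] - 'X_[nf u].
  split=> [/mapP[u]|[u minu ->]].
    by rewrite mem_filter => /andP[/asboolP minu _] ->; exists (val u).
  have lt_u : (mdeg u < B.+1)%N by rewrite ltnS (bound u (nf u)) ?nf_deg.
  by apply/mapP; exists (BMultinom lt_u); rewrite // mem_filter mem_enum andbT; apply/asboolP.
have neq_nf u : minimal_nonstandard u -> u != nf u.
  by move=> minu; rewrite pair_neq.
have le_nf u : le (nf u) u by apply: nf_std; rewrite nf_deg.
have leadG u : minimal_nonstandard u -> lead le ('X_[K, u] - 'X_[nf u]) = u.
  by move=> minu; rewrite lead_binomial ?neq_nf.
have GI : [set` G] `<=` I.
  by move=> g /GP[u _ ->]; apply: toric_binomial; rewrite nf_deg.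
exists G; first split; first split=> //.
- apply/seteqP; split; apply: ideal_gen_min => _ [f [If f0] <-].
    by apply: ideal_gen_sub; exists f => //; split=> //; apply: GI.
  have /minimal_nonstandard_divisor[u le_u minu] := lead_not_standard If (introN eqP f0).
  rewrite -(submK le_u) mpolyXD; apply/ideal_genMl/ideal_gen_sub.
  exists ('X_[u] - 'X_[nf u]); rewrite ?leadG //.
  by split; [apply/GP; exists u|apply/eqP/binomial_neq0/neq_nf].
- move=> _ /GP[u minu ->]; rewrite leadG // mcoeffB !mcoeffX eqxx.
  by rewrite eq_sym (negPf (neq_nf u minu)) subr0.
- move=> _ _ /GP[u minu ->] /GP[v minv ->] neq_gh w.
  rewrite leadG // msupp_binomial ?neq_nf // !inE => /orP[]/eqP->.
    apply: contra neq_gh => le_uv; have [->//|neq_uv] := eqVneq u v.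
    by case: minu => nsu _; case: nsu; apply: minv.2.
  by apply/negP => le_u; case: minu => nsu _; apply: nsu; apply: standard_divides le_u _.
apply: eq_ideal_gen => [g /GI//|_ [a [b [eq_ab ->]]]].
have toG c : standard c -> forall u, Adeg u = Adeg c ->
    ideal_gen [set` G] ('X_[u] - 'X_[c]).
  move=> stdc u eq_uc; apply: contrapT => bad_u.
  (* Take the [le]-least counterexample in the fibre: replacing a minimal nonstandard divisor [d] by
     [nf d] changes it by a multiple of an element of [G] and makes it smaller. *)
  pose P : set 'X_{1..m} := fun x => ~ ideal_gen [set` G] ('X_[x] - 'X_[c]).
  have [x [bad_x eq_xu minx]] := @fiber_min P u bad_u.
  have eq_xc : Adeg x = Adeg c by rewrite eq_xu.
  have nsx : ~ standard x.
    move=> stdx; apply: bad_x; rewrite (standard_uniq stdx stdc eq_xc) subrr.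
    exact: ideal_gen0.
  have [d le_dx mind] := minimal_nonstandard_divisor nsx.
  pose y := (nf d + (x - d))%MM.
  have eq_yx : Adeg y = Adeg x.
    by rewrite -[x in RHS](submK le_dx) [(_ + d)%MM]addmC !AdegreeD nf_deg.
  have le_yx : le y x.
    by rewrite -[x in X in le _ X](submK le_dx) [(_ + d)%MM]addmC; apply: le_D.
  have neq_yx : y != x.
    apply: contra (neq_nf d mind) => /eqP e; apply/eqP.
    by apply: (@addIm _ (x - d)%MM) => /=; rewrite -/y e addmC submK.
  have good_y : ideal_gen [set` G] ('X_[y] - 'X_[c]).
    apply: contrapT => bad_y; case/eqP: neq_yx; apply: le_anti.
    by rewrite le_yx minx // eq_yx.
  apply: bad_x; rewrite -(subrKA 'X_[y]); apply: ideal_genD good_y.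
  rewrite -{1}(submK le_dx) /y [(nf d + _)%MM]addmC !mpolyXD -mulrBr.
  by apply/ideal_genMl/ideal_gen_sub/GP; exists d.
rewrite -(subrKA 'X_[nf a]) -[X in _ + X]opprB; apply: ideal_genD.
  by apply: toG; rewrite ?nf_deg.
by rewrite -mulN1r; apply/ideal_genMl/toG; rewrite ?nf_deg.
Qed.

End Existence.
End MonomialOrder.
End Toric.

Lemma mnmc_monomial_order m : monomial_order (@mnmc_le m).
Proof.
split; split.
- by move=> u; rewrite -[mnmc_le _ _]leEmnm.
- by move=> u v; rewrite -![mnmc_le _ _]leEmnm => /le_anti.
- by move=> v u w; rewrite -![mnmc_le _ _]leEmnm; apply: le_trans.
- by move=> u v; rewrite -![mnmc_le _ _]leEmnm; apply: le_total.
- by move=> u; rewrite -[mnmc_le _ _]leEmnm le0m.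
by move=> u v w; rewrite -![mnmc_le _ _]leEmnm lemc_add2l.
Qed.

(** * Labellings of the binary tree and walks *)

Section HeapTree.
Implicit Types (s t : nat -> int) (i j : nat).

Lemma heap_rec (T : Type) (a : T) (f : nat -> T -> T * T) :
  exists s : nat -> T, s 0%N = a /\
    forall i, s i.*2.+1 = (f i (s i)).1 /\ s i.*2.+2 = (f i (s i)).2.
Proof.
(* [k] is fuel, and by [FE] any amount from [i] on gives the same value. Node [j.+1] has parent
   [j./2] and is the right child when [j] is odd. *)
pose F := fix F k i := if k is k'.+1 then
  if i is j.+1 then
    let: (b, c) := f j./2 (F k' j./2) in if odd j then c else b
  else a else a.
have F0 k : F k 0%N = a by case: k.
have FE k l i : (i <= k)%N -> (i <= l)%N -> F k i = F l i.
  elim: k l i => [|k IHk] [|l] [|i] //=; rewrite !ltnS => le_ik le_il.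
  by rewrite (IHk l) //; lia.
have FS k i : F k.+1 i.+1 =
    (if odd i then (f i./2 (F k i./2)).2 else (f i./2 (F k i./2)).1).
  by rewrite /=; case: (f _ _).
exists (fun i => F i i); split=> // i.
have odd2 : odd i.*2.+1 by rewrite /= odd_double.
have half2 : i.*2.+1./2 = i by rewrite /= uphalf_double.
split; first by rewrite FS odd_double doubleK (FE i.*2 i i) //; lia.
by rewrite FS odd2 half2 (FE i.*2.+1 i i) //; lia.
Qed.

Lemma heap_cases i : [\/ i = 0%N, exists j, i = j.*2.+1 | exists j, i = j.*2.+2].
Proof.
case: i => [|i]; first exact: Or31.
have := odd_double_half i; case: (odd i) => e; [apply: Or33|apply: Or32];
  by exists i./2; rewrite -{1}e.
Qed.

(* Solutions of the incidence equations of the triangle graph: the two entries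
   at the vertex shared by triangle [i] and its parent sum to [2 * t i] in
   triangle [i] and to [- 2 * t i] in the parent. *)
Definition triangle t i k : int :=
  match k with
  | 0%N => - (t i + t i.*2.+1 + t i.*2.+2)
  | 1%N => t i + t i.*2.+1 - t i.*2.+2
  | _ => t i - t i.*2.+1 + t i.*2.+2
  end.

(** [t i] labels the tree edge from node [i] up to its parent, so the root gets 0. Vanishing from
    [N] on lets the infinite heap stand for a tree with [N] nodes. *)
Definition edge_function N t := t 0%N = 0 /\ forall i, (N <= i)%N -> t i = 0.

Definition incidence_kernel (x : nat -> nat -> int) :=
  x 0%N 1%N + x 0%N 2%N = 0 /\ forall i,
    x i.*2.+1 1%N + x i.*2.+1 2%N + (x i 0%N + x i 2%N) = 0 /\
    x i.*2.+2 1%N + x i.*2.+2 2%N + (x i 0%N + x i 1%N) = 0.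

Lemma triangle_kernel t : t 0%N = 0 -> incidence_kernel (triangle t).
Proof. by move=> t0; split=> [|i] /=; lia. Qed.

(** The labels are half the sums at the shared vertices. These sums are even by induction from the
    leaves upwards: in a triangle, the sum at the parent vertex equals the other two vertex sums
    added, minus twice the entry opposite the parent vertex. *)
Lemma incidence_kernelP N x : incidence_kernel x ->
  (forall i k, (N <= i)%N -> x i k = 0) ->
  exists2 t, edge_function N t & forall i k, (k < 3)%N -> x i k = triangle t i k.
Proof.
move=> [x0 kx] xN.
have half i : exists a : int, x i 1%N + x i 2%N = a + a.
  have [k] := ubnP (N - i)%N; elim: k i => // k IHk i lt_k.
  have [/xN xi0|lt_iN] := leqP N i; first by exists 0; rewrite !xi0.
  have [|a ea] := IHk i.*2.+1; first lia.
  have [|b eb] := IHk i.*2.+2; first lia.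
  by have [? ?] := kx i; exists (- a - b - x i 0%N); lia.
have /choice[t te] := half; exists t.
  by split=> [|i leNi]; [have := te 0%N|have := te i; rewrite !xN //]; lia.
move=> i [|[|[|//]]] _ /=; have [] := kx i;
  have := te i; have := te i.*2.+1; have := te i.*2.+2; lia.
Qed.

Lemma triangle_eq0 t N : edge_function N t ->
  (forall i k, (i < N)%N -> (k < 3)%N -> triangle t i k = 0) -> forall i, t i = 0.
Proof.
move=> [t0 tN] y0 i; have [/tN//|lt_iN] := leqP N i.
by have /= := y0 i 1%N lt_iN isT; have /= := y0 i 2%N lt_iN isT; lia.
Qed.

Definition conformal (a b : int) := (0 <= a <= b) || (b <= a <= 0).

Definition unit_conformal (a b : int) :=
  [|| a == 0, (a == 1) && (0 < b) | (a == -1) && (b < 0)].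

Definition node_conformal (a b c p l r : int) :=
  [&& conformal (- (a + b + c)) (- (p + l + r)),
      conformal (a + b - c) (p + l - r) & conformal (a - b + c) (p - l + r)].

(** One step of the walk downwards. Entries 1 and 2 of the triangle of [t] sum to [2 * p]. If one of
    them is at least 2 (for positive [p]), the walk can continue into a single child or stop;
    otherwise parity may force it to branch. *)
Lemma node_step a p l r : unit_conformal a p -> exists b c,
  [/\ unit_conformal b l, unit_conformal c r, node_conformal a b c p l r
    & (b = - a /\ c = - a) \/ `|b| + `|c| <= `|a|].
Proof.
have pos p' l' r' : 0 < p' -> exists b c,
  [/\ unit_conformal b l', unit_conformal c r', node_conformal 1 b c p' l' r'
    & (b = - 1 /\ c = - 1) \/ `|b| + `|c| <= 1].
  rewrite /unit_conformal /node_conformal /conformal => p0.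
  have [ge1|lt1] := lerP 2 (p' + l' - r').
    have [?|?] := ltrP r' 0; first by exists 0, (-1); split; lia.
    have [?|?] := ltrP 0 l'; first by exists 1, 0; split; lia.
    have [?|?] := ltrP 0 r'; first by exists 0, 1; split; lia.
    have [?|?] := ltrP l' 0; first by exists (-1), 0; split; lia.
    by exists 0, 0; split; lia.
  have [ge2|lt2] := lerP 2 (p' - l' + r').
    have [?|?] := ltrP l' 0; first by exists (-1), 0; split; lia.
    have [?|?] := ltrP 0 r'; first by exists 0, 1; split; lia.
    have [?|?] := ltrP 0 l'; first by exists 1, 0; split; lia.
    have [?|?] := ltrP r' 0; first by exists 0, (-1); split; lia.
    by exists 0, 0; split; lia.
  (* Both entries are now below 2 with sum [2 * p'], so both are 1, [p' = 1] and [l' = r']. If [l']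
     is negative, the third entry is positive and only the labels of a pure node fit; otherwise the
     walk stops. *)
  have [?|?] := ltrP l' 0; first by exists (-1), (-1); split; lia.
  by exists 0, 0; split; lia.
case/or3P => [/eqP->|/andP[/eqP-> /pos]//|/andP[/eqP-> p0]].
  by exists 0, 0; rewrite /unit_conformal /node_conformal /conformal; split; lia.
have [|b [c]] := pos (- p) (- l) (- r); first lia.
rewrite /unit_conformal /node_conformal /conformal => -[? ? ? ?].
by exists (- b), (- c); split; lia.
Qed.

Lemma apex_step (l r : int) : l != 0 \/ r != 0 -> exists b c,
  [/\ unit_conformal b l, unit_conformal c r, node_conformal 0 b c 0 l r
    & b != 0 \/ c != 0].
Proof.
rewrite /unit_conformal /node_conformal /conformal.
have sg (x : int) : exists b : int, (b == 0) && (x == 0) || (b == 1) && (0 < x)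
    || (b == -1) && (x < 0).
  by case: (ltrgtP x 0) => ?; [exists (-1)|exists 1|exists 0]; lia.
have [b eb] := sg l; have [c ec] := sg r; exists b, c; split; lia.
Qed.

Definition pure_node s i :=
  [&& s i != 0, s i.*2.+1 == - s i & s i.*2.+2 == - s i].

Lemma conformal_triangle s t i :
  node_conformal (s i) (s i.*2.+1) (s i.*2.+2) (t i) (t i.*2.+1) (t i.*2.+2) ->
  forall k, conformal (triangle s i k) (triangle t i k).
Proof. by case/and3P=> ? ? ? [|[|k]]. Qed.

(* A walk is grown downwards from the parent of the topmost edge in the support
   of [t]; it branches only at pure nodes. *)
Lemma unit_walk N t : edge_function N t -> (exists i, t i != 0) -> exists s,
  [/\ edge_function N s, exists i, s i != 0, forall i, unit_conformal (s i) (t i),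
      forall i k, conformal (triangle s i k) (triangle t i k)
    & exists j, forall i, pure_node s i \/
        `|s i.*2.+1| + `|s i.*2.+2| <= `|s i| + 2 * (i == j)%:Z].
Proof.
(* Indices grow downwards, so the parent [j] of the least edge [e] in the support has label 0 and
   can serve as apex. *)
move=> [t0 tN] ext; case: (ex_minnP ext) => e te mine.
have [j ej] : exists j, e = j.*2.+1 \/ e = j.*2.+2.
  by case: (heap_cases e) te => [->|[j ->]|[j ->]]; rewrite ?t0 ?eqxx //; exists j; auto.
have tj : t j = 0 by apply/eqP/negPn/negP => /mine; lia.
(* The premise stands under the existential so that choice yields a total function; [(0, 0)] is the
   filler when it fails. *)
have step (ia : nat * int) : exists bc : int * int, unit_conformal ia.2 (t ia.1) ->
  [/\ unit_conformal bc.1 (t ia.1.*2.+1), unit_conformal bc.2 (t ia.1.*2.+2),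
      node_conformal ia.2 bc.1 bc.2 (t ia.1) (t ia.1.*2.+1) (t ia.1.*2.+2)
    & if ia.1 == j then bc.1 != 0 \/ bc.2 != 0
      else (bc.1 = - ia.2 /\ bc.2 = - ia.2) \/ `|bc.1| + `|bc.2| <= `|ia.2|].
  case: ia => i a /=; case: eqP => [->|_]; last first.
    have [ua|] := boolP (unit_conformal a (t i)); last by exists (0, 0).
    by have [b [c bc]] := node_step (t i.*2.+1) (t i.*2.+2) ua; exists (b, c).
  have [|b [c [ub uc nc bc]]] := @apex_step (t j.*2.+1) (t j.*2.+2).
    by case: ej => <-; auto.
  exists (b, c) => /=; rewrite tj => ua.
  suff -> : a = 0 by [].
  by move: ua; rewrite /unit_conformal; lia.
have {step} /choice[f fP] := step.
have [s [s0 sf]] := heap_rec 0 (fun i a => f (i, a)).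
have us i : unit_conformal (s i) (t i).
  have [k] := ubnP i; elim: k i => // k IHk i lt_ik.
  have [->|[p ep]|[p ep]] := heap_cases i; first by rewrite s0.
    have [|up _ _ _] := fP (p, s p); first by apply: IHk; lia.
    by rewrite ep (sf p).1.
  have [|_ up _ _] := fP (p, s p); first by apply: IHk; lia.
  by rewrite ep (sf p).2.
have sP i := fP (i, s i) (us i); exists s; split=> //.
- split=> // i /tN ti; have := us i; rewrite /unit_conformal ti; lia.
- have [_ _ _ /=] := sP j; rewrite eqxx -(sf j).1 -(sf j).2.
  by case=> ?; [exists j.*2.+1|exists j.*2.+2].
- move=> i; apply: conformal_triangle; have [_ _ + _] := sP i.
  by rewrite (sf i).1 (sf i).2.
exists j => i; have [/= _ _ _] := sP i; rewrite -(sf i).1 -(sf i).2.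
have := us i.*2.+1; have := us i.*2.+2; have := us i.
rewrite /unit_conformal /pure_node; case: (eqVneq i j) => [->|_] /= u1 u2 u3; first lia.
by case=> [[-> ->]|?]; lia.
Qed.

Lemma sum_children (f : nat -> nat) a b : (a <= b)%N ->
  (\sum_(a.*2.+1 <= i < b.*2.+1) f i = \sum_(a <= i < b) (f i.*2.+1 + f i.*2.+2))%N.
Proof.
move=> /subnKC <-; elim: (b - a)%N => [|k IHk].
  by rewrite addn0 !big_geq.
rewrite addnS doubleS big_nat_recr /=; last lia.
rewrite big_nat_recr /=; last lia.
by rewrite IHk big_nat_recr /= ?addnA //; lia.
Qed.

Lemma sum_delta j n : (\sum_(0 <= i < n) (i == j) <= 1)%N.
Proof.
by rewrite -big_mkcond sum1_count count_uniq_mem ?iota_uniq // leq_b1.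
Qed.

(** The children of one level form the next one, so the sum over a level grows only by the 2 granted
    at [j], and only once. Hence each of the [r] levels has sum at most 2. *)
Lemma heap_sum (a : nat -> nat) j r : a 0%N = 0%N ->
  (forall i, a i.*2.+1 + a i.*2.+2 <= a i + 2 * (i == j))%N ->
  (\sum_(0 <= i < (2 ^ r).-1) a i <= 2 * r)%N.
Proof.
move=> a0 step; have pow l : (2 ^ l.+1).-1 = (2 ^ l).-1.*2.+1.
  by rewrite expnS; have := expn_gt0 2 l; lia.
have mono l : ((2 ^ l).-1 <= (2 ^ l.+1).-1)%N by rewrite pow; lia.
have level l : (\sum_((2 ^ l).-1 <= i < (2 ^ l.+1).-1) a i
    <= 2 * \sum_(0 <= i < (2 ^ l).-1) (i == j))%N.
  elim: l => [|l IHl]; first by rewrite big_nat1 a0.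
  rewrite [X in (\sum_(_ <= i < X) _)%N]pow {1}pow sum_children //.
  apply: (@leq_trans (\sum_((2 ^ l).-1 <= i < (2 ^ l.+1).-1) (a i + 2 * (i == j)))%N).
    by apply: leq_sum => i _; apply: step.
  rewrite big_split /= -big_distrr /= (big_cat_nat (leq0n _) (mono l)) /= mulnDr.
  by rewrite leq_add2r.
elim: r => [|r IHr]; first by rewrite big_geq.
rewrite (big_cat_nat (leq0n _) (mono r)) /= mulnS addnC leq_add //.
apply: leq_trans (level r) _; rewrite -[leqRHS]muln1 leq_mul2l /=.
exact: sum_delta.
Qed.

Definition triangle_norm s N : nat :=
  \sum_(0 <= i < N) (`|triangle s i 0| + `|triangle s i 1| + `|triangle s i 2|).

Lemma walk_norm s j r N : edge_function N s ->
  (forall i, `|s i.*2.+1| + `|s i.*2.+2| <= `|s i| + 2 * (i == j)%:Z) ->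
  (triangle_norm s (2 ^ r).-1 <= 12 * r + 6)%N.
Proof.
move=> [s0 _] step; pose a i := `|s i|%N.
have sum_a : (\sum_(0 <= i < (2 ^ r).-1) a i <= 2 * r)%N.
  by apply: (@heap_sum a j); rewrite /a ?s0 // => i; have := step i; lia.
have /leq_trans : (triangle_norm s (2 ^ r).-1
    <= \sum_(0 <= i < (2 ^ r).-1) (6 * a i + 6 * (i == j)))%N.
  by apply: leq_sum => i _; have := step i; rewrite /a /=; lia.
apply; rewrite big_split /= -!big_distrr /=.
have := sum_delta j (2 ^ r).-1.
move: (\sum_(_ <= i < _) (i == j))%N sum_a; move: (\sum_(_ <= i < _) a i)%N; lia.
Qed.

Lemma unit_norm s t N : (forall i, unit_conformal (s i) (t i)) ->
  (triangle_norm s N <= 9 * N)%N.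
Proof.
move=> us; rewrite mulnC -[N in leqRHS]subn0 -sum_nat_const_nat; apply: leq_sum => i _ /=.
have := us i; have := us i.*2.+1; have := us i.*2.+2; rewrite /unit_conformal; lia.
Qed.

(** Removing node [i] splits the tree into the left subtree (1), the right subtree (2) and the rest
    (0). The labels at a pure node are [a], [-a], [-a], and zeroing any one of them leaves a single
    entry [2 * a]. Each branch has an entry of sign opposite to [s i] because the neighbouring
    triangle has entry sum [- 2 * s i] at the shared vertex. *)
Lemma pure_node_branches N s i : edge_function N s -> pure_node s i ->
    `|s i| = 1 ->
  exists lab : nat -> nat, [/\ forall j, (lab j < 3)%N,
    forall k j k', j != i ->
      triangle (fun j => if lab j == k then 0 else s j) j k'
      = if lab j == k then 0 else triangle s j k',
    forall k k', (k < 3)%N -> (k' < 3)%N ->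
      triangle (fun j => if lab j == k then 0 else s j) i k'
      = if k' == k then 2 * s i else 0
    & forall k, (k < 3)%N -> exists j k',
      [/\ j != i, (k' < 3)%N, lab j = k & triangle s j k' * s i < 0]].
Proof.
move=> [s0 _] /and3P[si /eqP sl /eqP sr] si1.
have [lab [lab0 labS]] := heap_rec 0%N (fun p a => if p == i then (1, 2) else (a, a))%N.
have lab_le j : (j <= i)%N -> lab j = 0%N.
  have [k] := ubnP j; elim: k j => // k IHk j lt_jk le_ji.
  have [->//|[p ep]|[p ep]] := heap_cases j; rewrite ep.
    by rewrite (labS p).1 ifN ?IHk //; lia.
  by rewrite (labS p).2 ifN ?IHk //; lia.
have lab_l : lab i.*2.+1 = 1%N by rewrite (labS i).1 eqxx.
have lab_r : lab i.*2.+2 = 2%N by rewrite (labS i).2 eqxx.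
have lab_i : lab i = 0%N by apply: lab_le.
have lab_child j : j != i -> lab j.*2.+1 = lab j /\ lab j.*2.+2 = lab j.
  by move=> neq_ji; rewrite (labS j).1 (labS j).2 (negPf neq_ji).
exists lab; split.
- move=> j; have [k] := ubnP j; elim: k j => // k IHk j lt_jk.
  have [->|[p ep]|[p ep]] := heap_cases j; first by rewrite lab0.
    by rewrite ep (labS p).1; case: ifP => // _; apply: IHk; lia.
  by rewrite ep (labS p).2; case: ifP => // _; apply: IHk; lia.
- move=> k j k' /lab_child[e1 e2]; case: k' => [|[|k']] /=; rewrite e1 e2; case: eqP => //.
- move=> [|[|[|//]]] [|[|[|//]]] _ _ /=; rewrite lab_l lab_r lab_i /=; lia.
have sgn (x y : int) : x + y = - 2 * s i -> x * s i < 0 \/ y * s i < 0 by nia.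
have i0 : i != 0%N by apply: contraNneq si => ->; rewrite s0.
move=> [|[|[|//]]] _.
- have [ei|[j ej]|[j ej]] := heap_cases i; first by rewrite ei in i0.
    have [|?|?] := @sgn (triangle s j 0) (triangle s j 2); first by rewrite ej /=; lia.
      by exists j, 0%N; split=> //; [|apply: lab_le]; lia.
    by exists j, 2%N; split=> //; [|apply: lab_le]; lia.
  have [|?|?] := @sgn (triangle s j 0) (triangle s j 1); first by rewrite ej /=; lia.
    by exists j, 0%N; split=> //; [|apply: lab_le]; lia.
  by exists j, 1%N; split=> //; [|apply: lab_le]; lia.
- have [|?|?] := @sgn (triangle s i.*2.+1 1) (triangle s i.*2.+1 2); first by rewrite /=; lia.
    by exists i.*2.+1, 1%N; split=> //; lia.
  by exists i.*2.+1, 2%N; split=> //; lia.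
have [|?|?] := @sgn (triangle s i.*2.+2 1) (triangle s i.*2.+2 2); first by rewrite /=; lia.
  by exists i.*2.+2, 1%N; split=> //; lia.
by exists i.*2.+2, 2%N; split=> //; lia.
Qed.

End HeapTree.

(** Signs alternate with depth, so every node other than the root with both children in range is
    pure. A conformal labelling must then make the same choice, all or nothing, at a node and its
    children; the root links its two subtrees. *)
Lemma alternating_function N : (2 < N)%N -> exists t : nat -> int,
  [/\ edge_function N t, forall i, (0 < i < N)%N -> `|t i| = 1
    & forall s, edge_function N s ->
        (forall i k, conformal (triangle s i k) (triangle t i k)) ->
        (forall i, s i = 0) \/ (forall i, s i = t i)].
Proof.
move=> N2; have [d [d0 dS]] := heap_rec (1 : int) (fun _ a => (- a, - a)).
have d1 i : `|d i| = 1.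
  have [k] := ubnP i; elim: k i => // k IHk i lt_ik.
  by have [->|[p ep]|[p ep]] := heap_cases i;
    rewrite ?d0 // ep ?(dS p).1 ?(dS p).2 /= normrN IHk //; lia.
pose t i := if (0 < i < N)%N then d i else 0.
have tE i : (0 < i < N)%N -> t i = d i by rewrite /t => ->.
have tN i : (N <= i)%N -> t i = 0 by rewrite /t => ?; rewrite ifN //; lia.
have t0 : t 0%N = 0 by [].
exists t; split=> [|i lt_iN|s [s0 sN] conf]; [by split| |].
  by rewrite tE.
(* With both children present, the three entries of [t] equal [p] and those of [s] are 0 or [p];
   their pairwise sums are even, so they agree. A child out of range has label 0 on both sides. *)
have node a b c p l r : `|p| = 1 -> (l = - p \/ (l = 0 /\ b = 0)) ->
    (r = - p \/ (r = 0 /\ c = 0)) -> node_conformal a b c p l r ->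
    [/\ a = 0 \/ a = p, l = - p -> b = - a & r = - p -> c = - a].
  by rewrite /node_conformal /conformal => *; split; lia.
have conf' i : node_conformal (s i) (s i.*2.+1) (s i.*2.+2) (t i) (t i.*2.+1) (t i.*2.+2).
  by rewrite /node_conformal; apply/and3P; split;
    [apply: (conf i 0%N)|apply: (conf i 1%N)|apply: (conf i 2%N)].
have tS i : (0 < i < N)%N -> [/\ s i = 0 \/ s i = t i,
    (i.*2.+1 < N)%N -> s i.*2.+1 = - s i /\ t i.*2.+1 = - t i
    & (i.*2.+2 < N)%N -> s i.*2.+2 = - s i /\ t i.*2.+2 = - t i].
  move=> lt_iN; have t1 : `|t i| = 1 by rewrite tE.
  have tl : (i.*2.+1 < N)%N -> t i.*2.+1 = - t i.
    by move=> lt_l; rewrite !tE ?(dS i).1 //; lia.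
  have tr : (i.*2.+2 < N)%N -> t i.*2.+2 = - t i.
    by move=> lt_r; rewrite !tE ?(dS i).2 //; lia.
  have [||? cl cr] := node _ _ _ _ _ _ t1 _ _ (conf' i).
  - by case: (ltnP i.*2.+1 N) => [/tl|le]; [left|right; rewrite tN ?sN].
  - by case: (ltnP i.*2.+2 N) => [/tr|le]; [left|right; rewrite tN ?sN].
  by split=> // [/tl|/tr] e; rewrite ?cl ?cr.
have t1E : t 1%N = -1 by rewrite tE ?(dS 0%N).1 ?d0 //; lia.
have t2E : t 2%N = -1 by rewrite tE ?(dS 0%N).2 ?d0 //; lia.
have s12 : s 1%N = s 2%N.
  have : node_conformal (s 0%N) (s 1%N) (s 2%N) (t 0%N) (t 1%N) (t 2%N) := conf' 0%N.
  by rewrite /node_conformal /conformal s0 t0 t1E t2E; lia.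
have main (c : int) : s 1%N = c * t 1%N -> forall i, (0 < i < N)%N -> s i = c * t i.
  move=> s1 i; have [k] := ubnP i; elim: k i => // k IHk i lt_ik lt_iN.
  have [ei|[p ep]|[p ep]] := heap_cases i; first by rewrite ei in lt_iN.
    have [p0|p0] := posnP p; first by rewrite ep p0.
    have lt_p : (0 < p < N)%N by lia.
    have [_ sl _] := tS p lt_p; rewrite ep.
    have [|-> ->] := sl; first by rewrite -ep; lia.
    by rewrite mulrN IHk //; lia.
  have [p0|p0] := posnP p; first by rewrite ep p0 -s12 s1 t1E t2E.
  have lt_p : (0 < p < N)%N by lia.
  have [_ _ sr] := tS p lt_p; rewrite ep.
  have [|-> ->] := sr; first by rewrite -ep; lia.
  by rewrite mulrN IHk //; lia.
have ext (c : int) : s 1%N = c * t 1%N -> forall i, s i = c * t i.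
  move=> /main sc i; have [->|i0] := posnP i; first by rewrite s0 t0 mulr0.
  by have [le|lt_iN] := leqP N i; [rewrite sN ?tN ?mulr0|apply: sc; rewrite i0].
have [|[e|e] _ _] := tS 1%N; first lia.
  by left=> i; rewrite (ext 0) ?mul0r.
by right=> i; rewrite (ext 1) ?mul1r.
Qed.

(** In every triangle but the root, entries 1 and 2 sum to [2 * t i] and so contribute at least
    2. *)
Lemma alternating_norm t N : (forall i, (0 < i < N)%N -> `|t i| = 1 :> int) ->
  (2 * N.-1 <= triangle_norm t N)%N.
Proof.
case: N => // N t1; rewrite /triangle_norm big_nat_recl //=.
apply: leq_trans (leq_addl _ _); rewrite mulnC -[N in leqLHS]subn0 -sum_nat_const_nat.
rewrite big_nat [leqRHS]big_nat; apply: leq_sum => i lt_iN.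
by have := t1 i.+1 lt_iN; rewrite /=; lia.
Qed.

(** Two triangles sharing a vertex carry a circuit: outside them entries 1 and 2 vanish, and with
    them half their sum, which is the label. *)
Lemma single_edge_support N t : edge_function N t ->
  (forall i k, (i < N)%N -> (k < 3)%N -> triangle t i k != 0 ->
    triangle (fun i => (i == 1%N)%:Z) i k != 0) ->
  forall i k, triangle t i k = t 1%N * triangle (fun i => (i == 1%N)%:Z) i k.
Proof.
move=> [t0 tN] supp; have tE i : t i = t 1%N * (i == 1%N)%:Z.
  have [->|i1] := eqVneq i 1%N; first by rewrite mulr1.
  rewrite mulr0; have [->//|i0] := posnP i; have [/tN//|lt_iN] := leqP N i.
  have := supp i 1%N lt_iN isT; have := supp i 2%N lt_iN isT; rewrite /=.
  have -> : (i == 1%N) = false by apply: negPf.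
  have -> : (i.*2.+1 == 1%N) = false by apply/negbTE; lia.
  by lia.
by move=> i [|[|k]] /=; rewrite (tE i) (tE i.*2.+1) (tE i.*2.+2); lia.
Qed.

(** * Growth estimates *)

Lemma linear_lt_exp a b : exists j, (a + b * j < 2 ^ j)%N.
Proof.
(* Both [a] and [2 * b] are at most [i], so with [j = 2 * i] the left side is below the square of
   [i.+1], hence below [2 ^ j]. *)
pose i := (2 * b + a)%N; exists (2 * i)%N; have lt_i : (i < 2 ^ i)%N by apply: ltn_expl.
have : (i.+1 ^ 2 <= 2 ^ (2 * i))%N by rewrite mulnC expnM leq_exp2r.
by apply: leq_trans; rewrite /i; nia.
Qed.

Lemma polynomial_lt_exp C k : exists r,
  (1 < r)%N /\ (C * (12 * r + 7) ^ k < 2 ^ r - 2)%N.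
Proof.
have [j lt_j] := linear_lt_exp (C + 2 + 5 * k) k.
(* With [r] a power of 2 only exponents linear in [j] remain to be compared with [2 ^ j]. The
   summand 2 in the choice of [j] leaves a spare factor 4, which absorbs the [- 2]. The 7 is the 6
   of the degree bound plus the 1 of [horner_le_nat]. *)
exists (2 ^ j)%N; split; first by lia.
have le1 : (12 * 2 ^ j + 7 <= 2 ^ (j + 5))%N.
  by rewrite expnD; have := expn_gt0 2 j; lia.
have le2 : ((12 * 2 ^ j + 7) ^ k <= 2 ^ ((j + 5) * k))%N.
  rewrite expnM; case: (k) => // k'; by rewrite leq_exp2r.
have lt_C : (C < 2 ^ C)%N by apply: ltn_expl.
have le3 : (2 ^ (C + 2 + (j + 5) * k) <= 2 ^ (2 ^ j))%N.
  by rewrite leq_exp2l //; lia.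
rewrite !expnD in le3; have := expn_gt0 2 ((j + 5) * k).
move: (2 ^ ((j + 5) * k))%N (2 ^ C)%N (2 ^ 2 ^ j)%N ((12 * 2 ^ j + 7) ^ k)%N le2 lt_C le3.
by move=> X Y Z W; nia.
Qed.

Lemma horner_le_nat (R : archiRealFieldType) (p : {poly R}) :
  exists C k : nat, forall d : nat, p.[d%:R] <= (C * (d + 1) ^ k)%:R.
Proof.
pose S := \sum_(i < size p) `|p`_i|.
exists (Num.bound S), (size p) => d.
have S0 : 0 <= S by apply: sumr_ge0.
have leS : S <= (Num.bound S)%:R by apply/ltW/archi_boundP.
rewrite natrM horner_coef; apply: (@le_trans _ _ (S * ((d + 1) ^ size p)%:R)).
  rewrite mulr_suml; apply: ler_sum => i _.
  apply: (@le_trans _ _ (`|p`_i| * d%:R ^+ i)).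
    by apply: ler_wpM2r; [rewrite exprn_ge0|rewrite ler_norm].
  apply: ler_wpM2l => //; rewrite -natrX ler_nat.
  (* The base is shifted to [d + 1] because powers of 0 do not increase with the exponent. *)
  apply: (@leq_trans ((d + 1) ^ i)%N).
    by case: (nat_of_ord i) => // i'; rewrite leq_exp2r //; lia.
  by apply: leq_pexp2l; [rewrite addn1|apply/ltnW].
by apply: ler_wpM2r.
Qed.

Local Arguments triangle : simpl never.

(** * The incidence matrix of the triangle graph and its kernel *)

Section Cactus.
Variable N : nat.
Local Notation m := (N * 3)%N.
Implicit Types (u v w z : 'X_{1..N * 3}) (s t : nat -> int) (i j k e : nat).

(* Variable [3 * i + k] is the edge of triangle [i] opposite to its [k]-th
   vertex; the vertices of triangle [i] are [i], [2i+1] and [2i+2]. *)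
Definition incidence i k e : nat :=
  ((i == e) && (k != 0)) + ((i.*2.+1 == e) && (k != 1)) + ((i.*2.+2 == e) && (k != 2)).

Definition cactus (a : 'I_m) : 'rV[int]_(N.*2.+1) :=
  \row_e (incidence (a %/ 3) (a %% 3) e)%:Z.

Definition coord u i k : nat := nth 0%N u (i * 3 + k).

Lemma coord_divmod u (a : 'I_m) : u a = coord u (a %/ 3) (a %% 3).
Proof. by rewrite (mnm_nth 0%N) /coord -divn_eq. Qed.

Lemma coord_out u i k : (N <= i)%N -> coord u i k = 0%N.
Proof. by move=> leNi; rewrite /coord nth_default // size_tuple; lia. Qed.

Lemma ord_of_coord i k : (i < N)%N -> (k < 3)%N ->
  exists a : 'I_m, (a %/ 3)%N = i /\ (a %% 3)%N = k.
Proof.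
move=> lt_iN lt_k; have lt_a : (i * 3 + k < m)%N by lia.
by exists (Ordinal lt_a) => /=; lia.
Qed.

Lemma coord_eq u v :
  (forall i k, (i < N)%N -> (k < 3)%N -> coord u i k = coord v i k) -> u = v.
Proof.
move=> eq_uv; apply/mnmP => a; rewrite !coord_divmod; apply: eq_uv.
  by have := ltn_ord a; lia.
by rewrite ltn_mod.
Qed.

Lemma coord_le u v :
  (u <= v)%MM <-> forall i k, (k < 3)%N -> (coord u i k <= coord v i k)%N.
Proof.
split=> [/mnm_lepP le_uv i k lt_k|le_uv]; last first.
  by apply/mnm_lepP => a; rewrite !coord_divmod; apply: le_uv; rewrite ltn_mod.
have [/coord_out->//|lt_i] := leqP N i.
have [a [ea1 ea2]] := ord_of_coord lt_i lt_k.
by have := le_uv a; rewrite !coord_divmod ea1 ea2.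
Qed.

Definition of_coord (f : nat -> nat -> nat) : 'X_{1..m} :=
  [multinom f (a %/ 3)%N (a %% 3)%N | a < m].

Lemma of_coordK f i k : (i < N)%N -> (k < 3)%N -> coord (of_coord f) i k = f i k.
Proof.
move=> lt_i lt_k; have [a [ea1 ea2]] := ord_of_coord lt_i lt_k.
by rewrite -ea1 -ea2 -coord_divmod mnmE.
Qed.

Lemma coordD u v i k : coord (u + v)%MM i k = (coord u i k + coord v i k)%N.
Proof.
have [leN|lt_im] := leqP m (i * 3 + k)%N.
  by rewrite /coord !nth_default ?size_tuple.
by rewrite /coord -!(mnm_nth 0%N _ (Ordinal lt_im)) mnmDE.
Qed.

Lemma sum_coord (F : nat -> nat) :
  (\sum_(a < m) F a = \sum_(0 <= i < N) (F (i * 3) + F (i * 3 + 1) + F (i * 3 + 2)))%N.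
Proof.
rewrite -(big_mkord xpredT F); elim: N => [|M IHM]; first by rewrite !big_geq.
rewrite mulSn addnC !addnS addn0 !big_nat_recr //= IHM.
by rewrite -!addnA !addn1 addn2.
Qed.

Lemma mdeg_coord u : mdeg u =
  (\sum_(0 <= i < N) (coord u i 0 + coord u i 1 + coord u i 2))%N.
Proof.
rewrite mdegE (eq_bigr (fun a : 'I_m => nth 0%N u a)) => [|a _]; last by rewrite (mnm_nth 0%N).
by rewrite (sum_coord (nth 0%N u)); apply: eq_bigr => i _; rewrite /coord addn0.
Qed.

Definition vertex_degree u e : nat :=
  \sum_(0 <= i < N) (incidence i 0 e * coord u i 0
    + incidence i 1 e * coord u i 1 + incidence i 2 e * coord u i 2).

Lemma Adegree_cactus u (e : 'I_(N.*2.+1)) :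
  Adegree cactus u 0 e = (vertex_degree u e)%:Z.
Proof.
rewrite /Adegree summxE.
rewrite (eq_bigr (fun a : 'I_m => (incidence (a %/ 3) (a %% 3) e * nth 0%N u a)%N%:Z)).
  rewrite -(big_morph Posz PoszD (erefl _)) (sum_coord (fun a => incidence (a %/ 3) (a %% 3) e * nth 0 u a)%N).
  congr (_%:Z); apply: eq_bigr => i _.
  by rewrite /coord addn0 mulnK // modnMl !divnMDl // !modnMDl divn_small //= addn0.
by move=> a _; rewrite mulmxnE mxE (mnm_nth 0%N); lia.
Qed.

Lemma sum_pick (f : nat -> nat) e : (forall i, (N <= i)%N -> f i = 0%N) ->
  (\sum_(0 <= i < N) (i == e) * f i = f e)%N.
Proof.
move=> fN; have [leN|lt_e] := leqP N e.
  rewrite fN // big1_seq // => i; rewrite mem_index_iota /= => lt_i.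
  by rewrite (_ : (i == e) = false) //; lia.
rewrite big_mkord (bigD1 (Ordinal lt_e)) //= eqxx mul1n big1 ?addn0 // => i.
by rewrite -val_eqE /= => /negPf->.
Qed.

Lemma vertex_degree0 u : vertex_degree u 0 = (coord u 0 1 + coord u 0 2)%N.
Proof.
rewrite -(@sum_pick (fun i => coord u i 1 + coord u i 2)%N) => [|i leN]; last by rewrite !coord_out.
by apply: eq_bigr => i _; rewrite /incidence; lia.
Qed.

Lemma vertex_degree_left u j : vertex_degree u j.*2.+1
  = (coord u j.*2.+1 1 + coord u j.*2.+1 2 + (coord u j 0 + coord u j 2))%N.
Proof.
rewrite -(@sum_pick (fun i => coord u i 1 + coord u i 2)%N) => [|i leN]; last by rewrite !coord_out.
rewrite -(@sum_pick (fun i => coord u i 0 + coord u i 2)%N) => [|i leN]; last by rewrite !coord_out.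
have e1 i : (i.*2.+1 == j.*2.+1) = (i == j) by apply/eqP/eqP; lia.
have e2 i : (i.*2.+2 == j.*2.+1) = false by apply/eqP; lia.
rewrite -big_split; apply: eq_bigr => i _; rewrite /incidence e1 e2 /=.
by case: (i == j); case: (i == _) => /=; lia.
Qed.

Lemma vertex_degree_right u j : vertex_degree u j.*2.+2
  = (coord u j.*2.+2 1 + coord u j.*2.+2 2 + (coord u j 0 + coord u j 1))%N.
Proof.
rewrite -(@sum_pick (fun i => coord u i 1 + coord u i 2)%N) => [|i leN]; last by rewrite !coord_out.
rewrite -(@sum_pick (fun i => coord u i 0 + coord u i 1)%N) => [|i leN]; last by rewrite !coord_out.
have e1 i : (i.*2.+1 == j.*2.+2) = false by apply/eqP; lia.
have e2 i : (i.*2.+2 == j.*2.+2) = (i == j) by apply/eqP/eqP; lia.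
rewrite -big_split; apply: eq_bigr => i _; rewrite /incidence e1 e2 /=.
by case: (i == j); case: (i == _) => /=; lia.
Qed.

Definition diff u v i k : int := (coord u i k)%:Z - (coord v i k)%:Z.

Lemma eq_Adegree u v :
  Adegree cactus u = Adegree cactus v <-> incidence_kernel (diff u v).
Proof.
split=> [eq_uv|[k0 kS]].
  have vd e : (e < N.*2.+1)%N -> vertex_degree u e = vertex_degree v e.
    move=> lt_e; have := congr1 (fun M : 'rV_ _ => M 0 (Ordinal lt_e)) eq_uv.
    by rewrite !Adegree_cactus => -[].
  split=> [|i]; first by have := vd 0%N isT; rewrite !vertex_degree0 /diff; lia.
  rewrite /diff; have [leN|lt_i] := leqP N i.
    by rewrite !coord_out //; lia.
  have := vd i.*2.+1; rewrite !vertex_degree_left => e1.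
  have := vd i.*2.+2; rewrite !vertex_degree_right => e2.
  by split; [have := e1 ltac:(lia)|have := e2 ltac:(lia)]; lia.
apply/rowP => e; rewrite !Adegree_cactus; congr (_%:Z).
have [->|[j ->]|[j ->]] := heap_cases e; move: k0 (kS 0%N);
  rewrite /diff ?vertex_degree0 ?vertex_degree_left ?vertex_degree_right; first lia.
  by have [] := kS j; rewrite /diff; lia.
by have [] := kS j; rewrite /diff; lia.
Qed.

Lemma diff_triangle u v : Adegree cactus u = Adegree cactus v ->
  exists2 t, edge_function N t & forall i k, (k < 3)%N -> diff u v i k = triangle t i k.
Proof.
move/eq_Adegree/(@incidence_kernelP N); apply=> i k leN.
by rewrite /diff !coord_out.
Qed.

Lemma triangle_out t i k : edge_function N t -> (N <= i)%N -> triangle t i k = 0.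
Proof. by move=> [_ tN] leN; case: k => [|[|k]]; rewrite /triangle !tN //; lia. Qed.

Lemma triangle_diff t u v : edge_function N t ->
  (forall i k, (i < N)%N -> (k < 3)%N -> diff u v i k = triangle t i k) ->
  Adegree cactus u = Adegree cactus v.
Proof.
move=> et eqd; apply/eq_Adegree.
have eqd' i k : (k < 3)%N -> diff u v i k = triangle t i k.
  move=> lt_k; have [leN|lt_i] := leqP N i; last exact: eqd.
  by rewrite triangle_out // /diff !coord_out.
have [k0 kS] := triangle_kernel et.1.
by split=> [|i]; rewrite !eqd'.
Qed.

(** Double counting: every edge has two ends, so the coordinates of the [A]-degree sum to twice the
    degree. *)
Lemma cactus_graded u v : Adegree cactus u = Adegree cactus v -> mdeg u = mdeg v.
Proof.
have main w : (\sum_(0 <= e < N.*2.+1) vertex_degree w e = 2 * mdeg w)%N.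
  rewrite /vertex_degree exchange_big_nat /= mdeg_coord big_distrr.
  apply: eq_big_nat => i lt_i /=.
  have one b : (b < N.*2.+1)%N -> (\sum_(0 <= e < N.*2.+1) (b == e) = 1)%N.
    move=> lt_b; rewrite big_mkord (bigD1 (Ordinal lt_b)) //= eqxx big1 // => e.
    by rewrite eq_sym -val_eqE /= => /negPf->.
  rewrite (eq_bigr (fun e => (i == e) * (coord w i 1 + coord w i 2)
    + (i.*2.+1 == e) * (coord w i 0 + coord w i 2)
    + (i.*2.+2 == e) * (coord w i 0 + coord w i 1))%N) => [|e _]; last first.
    by rewrite /incidence; case: (i == e); case: (_ == e); case: (_ == e) => /=; lia.
  by rewrite !big_split -!big_distrl /= !one; lia.
move=> eq_uv; apply/eqP; rewrite -(eqn_pmul2l (isT : 0 < 2)%N) -!main; apply/eqP.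
rewrite !big_mkord; apply: eq_bigr => e _.
have := congr1 (fun M : 'rV_ _ => M 0 e) eq_uv.
by rewrite !Adegree_cactus => -[].
Qed.

Lemma cactus_inj : injective cactus.
Proof.
move=> a b /rowP eq_ab.
have eqi e : (e < N.*2.+1)%N ->
    incidence (a %/ 3) (a %% 3) e = incidence (b %/ 3) (b %% 3) e.
  by move=> lt_e; have := eq_ab (Ordinal lt_e); rewrite !mxE => -[].
have lt_a := ltn_ord a; have lt_b := ltn_ord b.
apply: val_inj => /=; rewrite (divn_eq a 3) (divn_eq b 3).
have ka : (a %% 3 < 3)%N by rewrite ltn_mod.
have kb : (b %% 3 < 3)%N by rewrite ltn_mod.
have ia : (a %/ 3 < N)%N by lia.
have ib : (b %/ 3 < N)%N by lia.
move: (a %/ 3)%N (a %% 3)%N (b %/ 3)%N (b %% 3)%N ka kb ia ib eqi => i k i' k' ka kb ia ib eqi.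
have [-> ->] : i = i' /\ k = k'; last by [].
(* The two ends of an edge, in increasing order. They form the support of the column, and since the
   graph has no parallel edges they determine the edge. *)
pose lo (i k : nat) := if k == 0%N then i.*2.+1 else i.
pose hi (i k : nat) := if k == 2%N then i.*2.+1 else i.*2.+2.
have mem j l e : (l < 3)%N -> (0 < incidence j l e)%N = (lo j l == e) || (hi j l == e).
  rewrite /incidence /lo /hi; case: l => [|[|[|//]]] _ /=;
    by case: (j == e); case: (_ == e); case: (_ == e).
have ends j l : (j < N)%N -> (lo j l < hi j l < N.*2.+1)%N by rewrite /lo /hi; case: eqP; case: eqP; lia.
have lt1 := ends i k ia; have lt2 := ends i' k' ib.
have m1 : (0 < incidence i' k' (lo i k))%N by rewrite -eqi ?mem ?eqxx //; lia.
have m2 : (0 < incidence i' k' (hi i k))%N by rewrite -eqi ?mem ?eqxx ?orbT //; lia.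
have m3 : (0 < incidence i k (lo i' k'))%N by rewrite eqi ?mem ?eqxx //; lia.
have m4 : (0 < incidence i k (hi i' k'))%N by rewrite eqi ?mem ?eqxx ?orbT //; lia.
rewrite !mem // in m1 m2 m3 m4.
have [] : lo i k = lo i' k' /\ hi i k = hi i' k'.
  by move: (lo i k) (hi i k) (lo i' k') (hi i' k') lt1 lt2 m1 m2 m3 m4; lia.
clear -ka kb; rewrite /lo /hi.
by case: k ka => [|[|[|//]]] _; case: k' kb => [|[|[|//]]] _ /=; lia.
Qed.

Lemma cactus_ge0 (a : 'I_m) (e : 'I_(N.*2.+1)) : 0 <= cactus a 0 e.
Proof. by rewrite mxE. Qed.

Definition nonneg_part (x : int) : nat := if 0 <= x then `|x|%N else 0%N.

Lemma nonneg_partP x : exists a b : nat,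
  [/\ nonneg_part x = a, nonneg_part (- x) = b
    & x = a%:Z /\ b = 0%N \/ a = 0%N /\ x = - b%:Z].
Proof.
exists (nonneg_part x), (nonneg_part (- x)); split=> //; rewrite /nonneg_part.
by have [x0|x0] := lerP 0 x; [left|right]; case: ifP; lia.
Qed.

Definition positive_part t := of_coord (fun i k => nonneg_part (triangle t i k)).
Definition negative_part t := of_coord (fun i k => nonneg_part (- triangle t i k)).

Lemma positive_partE t i k : edge_function N t -> (k < 3)%N ->
  coord (positive_part t) i k = nonneg_part (triangle t i k).
Proof.
move=> et lt_k; have [leN|lt_i] := leqP N i; last by rewrite of_coordK.
by rewrite coord_out // triangle_out.
Qed.

Lemma negative_partE t i k : edge_function N t -> (k < 3)%N ->
  coord (negative_part t) i k = nonneg_part (- triangle t i k).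
Proof.
move=> et lt_k; have [leN|lt_i] := leqP N i; last by rewrite of_coordK.
by rewrite coord_out // triangle_out ?oppr0.
Qed.

Lemma parts_Adegree t : edge_function N t ->
  Adegree cactus (positive_part t) = Adegree cactus (negative_part t).
Proof.
move=> et; apply: (triangle_diff et) => i k _ lt_k.
rewrite /diff positive_partE // negative_partE //.
by have [? [? [-> -> ?]]] := nonneg_partP (triangle t i k); lia.
Qed.

Lemma parts_disjoint t a : (positive_part t a == 0%N) || (negative_part t a == 0%N).
Proof. by rewrite !mnmE; have [? [? [-> -> ?]]] := nonneg_partP (triangle t (a %/ 3) (a %% 3)); lia. Qed.

Lemma parts_neq t : edge_function N t -> (exists i, t i != 0) ->
  positive_part t != negative_part t.
Proof.
move=> et [i /eqP ti]; apply/eqP => e; apply: ti.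
apply: (triangle_eq0 et) => j k _ lt_k.
have := congr1 (fun w => coord w j k) e.
rewrite positive_partE // negative_partE //.
by have [? [? [-> -> ?]]] := nonneg_partP (triangle t j k); lia.
Qed.

Lemma disjoint_parts t u v : edge_function N t ->
  (forall a, (u a == 0%N) || (v a == 0%N)) ->
  (forall i k, (k < 3)%N -> diff u v i k = triangle t i k) ->
  u = positive_part t /\ v = negative_part t.
Proof.
move=> et disj dE; have main i k : (i < N)%N -> (k < 3)%N ->
    coord u i k = nonneg_part (triangle t i k) /\
    coord v i k = nonneg_part (- triangle t i k).
  move=> lt_i lt_k; have [a [ea1 ea2]] := ord_of_coord lt_i lt_k.
  have := disj a; rewrite !coord_divmod ea1 ea2 -dE // /diff.
  by have [? [? [-> -> ?]]] := nonneg_partP ((coord u i k)%:Z - (coord v i k)%:Z); lia.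
split; apply: coord_eq => i k lt_i lt_k; have [eu ev] := main i k lt_i lt_k.
  by rewrite positive_partE.
by rewrite negative_partE.
Qed.

Lemma conformal_parts s t : edge_function N s -> edge_function N t ->
  (forall i k, conformal (triangle s i k) (triangle t i k)) ->
  (positive_part s <= positive_part t)%MM /\ (negative_part s <= negative_part t)%MM.
Proof.
move=> es et conf; split; apply/coord_le => i k lt_k;
  rewrite ?positive_partE ?negative_partE //;
  have := conf i k; rewrite /conformal;
  have [? [? [e1 e2 ?]]] := nonneg_partP (triangle s i k);
  by have [? [? [e3 e4 ?]]] := nonneg_partP (triangle t i k);
    rewrite ?e1 ?e2 ?e3 ?e4; lia.
Qed.

Lemma parts_conformal s t u v : edge_function N t ->
  (forall i k, (k < 3)%N -> diff u v i k = triangle s i k) ->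
  (u <= positive_part t)%MM -> (v <= negative_part t)%MM ->
  forall i k, conformal (triangle s i k) (triangle t i k).
Proof.
move=> et dE /coord_le le_u /coord_le le_v.
have main i k : (k < 3)%N -> conformal (triangle s i k) (triangle t i k).
  move=> lt_k; have := le_u i k lt_k; have := le_v i k lt_k.
  rewrite positive_partE // negative_partE // -dE // /diff /conformal.
  by have [? [? [-> -> ?]]] := nonneg_partP (triangle t i k); lia.
by move=> i [|[|k]]; [apply: main|apply: main|apply: (main i 2%N)].
Qed.

Lemma mdeg_parts t : edge_function N t ->
  (mdeg (positive_part t) + mdeg (negative_part t) = triangle_norm t N)%N.
Proof.
move=> et; rewrite !mdeg_coord -big_split; apply: eq_bigr => i _ /=.
rewrite !positive_partE // !negative_partE //.
have [? [? [-> -> ?]]] := nonneg_partP (triangle t i 0).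
have [? [? [-> -> ?]]] := nonneg_partP (triangle t i 1).
have [? [? [-> -> ?]]] := nonneg_partP (triangle t i 2).
by lia.
Qed.

End Cactus.

(** * Degrees of Graver elements, circuits and reduced Groebner bases *)

Section Degrees.
Variables (K : fieldType) (N : nat).
Implicit Types (u v w z : 'X_{1..N * 3}) (s t : nat -> int) (i j k : nat).
Implicit Types f g : {mpoly K[N * 3]}.
Local Notation A := (@cactus N).

Lemma walk_in_binomial u v : u != v -> (forall a, (u a == 0%N) || (v a == 0%N)) ->
  Adegree A u = Adegree A v -> exists t s,
  [/\ edge_function N t, u = positive_part N t, v = negative_part N t,
      (edge_function N s) /\ (exists i, s i != 0)
    & [/\ forall i, unit_conformal (s i) (t i),
      forall i k, conformal (triangle s i k) (triangle t i k)
    & exists j, forall i, pure_node s i \/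
        `|s i.*2.+1| + `|s i.*2.+2| <= `|s i| + 2 * (i == j)%:Z]].
Proof.
move=> neq_uv disj eq_uv; have [t et dE] := diff_triangle eq_uv.
have [uE vE] := disjoint_parts et disj dE.
have t0 : exists i, t i != 0.
  apply: contrapT => no; case/eqP: neq_uv; apply: coord_eq => i k _ lt_k.
  have t0 j : t j = 0 by apply/eqP/negPn/negP => tj; apply: no; exists j.
  by have := dE i k lt_k; rewrite /diff; case: k {lt_k} => [|[|k]]; rewrite /triangle !t0; lia.
by have [s [es s0 us conf walk]] := unit_walk et t0; exists t, s.
Qed.

Lemma mdeg_part_le t : edge_function N t ->
  (maxn (mdeg (positive_part N t)) (mdeg (negative_part N t)) <= triangle_norm t N)%N.
Proof. by move/mdeg_parts; lia. Qed.

(** Primitivity identifies the binomial with the walk below it, whose three entries per triangle are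
    at most 3 in absolute value. The estimate makes the maximal Graver degree exist. *)
Lemma graver_degree f : graver_basis K A f -> (tdeg f <= 9 * N)%N.
Proof.
move=> [u [v [fE irr If prim]]]; rewrite fE in irr If prim *.
have neq_uv : u != v by case: irr => nz _ _; apply: contraNneq nz => ->; rewrite subrr.
have eq_uv : Adegree A u = Adegree A v by move/toric_binomialP: If.
have [t [s [et uE vE [es s0] [us conf _]]]] :=
  walk_in_binomial neq_uv (irreducible_disjoint irr) eq_uv.
have [le1 le2] := conformal_parts es et conf; rewrite -uE -vE in le1 le2.
have neq_s := parts_neq es s0.
have Is : toric_ideal K A ('X_[positive_part N s] - 'X_[negative_part N s]).
  by apply: toric_binomial; apply: parts_Adegree.
have [<-|neq_f] := eqVneq ('X_[positive_part N s] - 'X_[negative_part N s])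
    ('X_[u] - 'X_[v] : {mpoly K[N * 3]}).
  rewrite tdeg_binomial //; apply: leq_trans (mdeg_part_le es) _.
  exact: unit_norm us.
by have := prim _ _ neq_s Is neq_f; rewrite le1 le2.
Qed.

Lemma graver_large : (2 < N)%N ->
  exists2 f, graver_basis K A f & (N.-1 <= tdeg f)%N.
Proof.
move=> N2; have [t [et t1 prim]] := alternating_function N2.
have t0 : exists i, t i != 0 by exists 1%N; have := t1 1%N; lia.
set u := positive_part N t; set v := negative_part N t.
have neq_uv : u != v := parts_neq et t0.
have disj := parts_disjoint (N := N) t.
exists ('X_[u] - 'X_[v]); last first.
  rewrite tdeg_binomial //; have := alternating_norm t1; rewrite -mdeg_parts //.
  by rewrite -/u -/v; lia.
exists u, v; split=> //.
(* Node [N.-1] is a leaf, so entry 1 of its triangle is its label; this gives a variable of exponent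
   1. *)
- have lt_last : (N.-1 < N)%N by lia.
  have [a [ea1 ea2]] := ord_of_coord lt_last (isT : (1 < 3)%N).
  apply: (@irreducible_binomial K _ _ _ a) => //.
  rewrite !coord_divmod ea1 ea2 /u /v positive_partE // negative_partE //.
  have tri : triangle t N.-1 1 = t N.-1.
    rewrite /triangle (et.2 N.-1.*2.+1) ?(et.2 N.-1.*2.+2) ?addr0 ?subr0 //; lia.
  have := t1 N.-1; have [a1 [b1 [-> -> ?]]] := nonneg_partP (triangle t N.-1 1).
  by lia.
- exact/toric_binomial/parts_Adegree.
move=> w z neq_wz /toric_binomialP eq_wz neq_f; apply/negP => /andP[le_w le_z].
have [s es dE] := diff_triangle eq_wz.
have conf := parts_conformal et dE le_w le_z.
case: (prim s es conf) => sE.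
  case/eqP: neq_wz; apply: coord_eq => i k _ lt_k.
  by have := dE i k lt_k; rewrite /diff; case: k {lt_k} => [|[|k]]; rewrite /triangle !sE; lia.
have [wE zE] : w = u /\ z = v.
  split; apply: coord_eq => i k _ lt_k;
    move/coord_le/(_ i k lt_k): le_w; move/coord_le/(_ i k lt_k): le_z; have := dE i k lt_k;
    rewrite /u /v positive_partE // negative_partE // /diff;
    have -> : triangle s i k = triangle t i k;
    try (by case: k {lt_k} => [|[|k]]; rewrite /triangle !sE);
    by have [? [? [-> -> ?]]] := nonneg_partP (triangle t i k); lia.
by rewrite wE zE eqxx in neq_f.
Qed.

Lemma mem_mvars u v : (forall a, (u a == 0%N) || (v a == 0%N)) -> u != v ->
  forall t, (forall i k, (k < 3)%N -> diff u v i k = triangle t i k) ->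
  forall a, mvars ('X_[K, u] - 'X_[v]) a <-> triangle t (a %/ 3) (a %% 3) != 0.
Proof.
move=> disj neq_uv t dE a; rewrite mvars_binomial // /mkset.
have := disj a; rewrite -dE ?ltn_mod // /diff -!coord_divmod.
by split; lia.
Qed.

Lemma diff_parts t : edge_function N t -> forall i k, (k < 3)%N ->
  diff (positive_part N t) (negative_part N t) i k = triangle t i k.
Proof.
move=> et i k lt_k; rewrite /diff positive_partE // negative_partE //.
by have [? [? [-> -> ?]]] := nonneg_partP (triangle t i k); lia.
Qed.

Lemma triangle_lin (c d : int) s t i k :
  triangle (fun j => c * t j - d * s j) i k = c * triangle t i k - d * triangle s i k.
Proof. by case: k => [|[|k]]; rewrite /triangle; lia. Qed.

Lemma circuit_support t : edge_function N t -> (exists i, t i != 0) ->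
  (forall g, Defs.binomial K (N * 3) g -> toric_ideal K A g ->
    ~ mvars g `<` mvars ('X_[K, positive_part N t] - 'X_[negative_part N t])) ->
  forall s, edge_function N s -> (exists i, s i != 0) ->
  (forall i k, (k < 3)%N -> triangle s i k != 0 -> triangle t i k != 0) ->
  forall i k, (i < N)%N -> (k < 3)%N -> triangle t i k != 0 -> triangle s i k != 0.
Proof.
move=> et t0 mint s es s0 sub i k lt_i lt_k ti; apply/negP => si.
pose g : {mpoly K[N * 3]} := 'X_[positive_part N s] - 'X_[negative_part N s].
have mt := mem_mvars (parts_disjoint t) (parts_neq et t0) (diff_parts et).
have ms := mem_mvars (parts_disjoint s) (parts_neq es s0) (diff_parts es).
apply: (mint g).
- by exists (positive_part N s), (negative_part N s); split=> //; apply: parts_neq.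
- exact/toric_binomial/parts_Adegree.
split=> [a /ms sa|]; first by apply/mt/sub; rewrite ?ltn_mod.
have [a [ea1 ea2]] := ord_of_coord lt_i lt_k.
by move/(_ a); rewrite mt ms ea1 ea2 => /(_ ti); rewrite si.
Qed.

(** As [s2] is the sign of [t2], the proportionality factor from [s] to [t] is the integer
    [|t2|]. *)
Lemma unit_proportional (c d t1 s1 t2 s2 : int) : unit_conformal s2 t2 -> s2 != 0 ->
  c * t1 - d * s1 = 0 -> c * t2 - d * s2 = 0 -> c * (t1 - s1 * `|t2|%N%:Z) = 0.
Proof.
rewrite /unit_conformal => /or3P[/eqP->|/andP[/eqP-> te]|/andP[/eqP-> te]] // _ e1 e2.
  have -> : `|t2|%N%:Z = t2 by lia.
  by nia.
have -> : `|t2|%N%:Z = - t2 by lia.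
by nia.
Qed.

(** The support of the walk [s] lies in that of [t], so minimality makes [t] a multiple of [s], and
    irreducibility makes the factor 1. Only then can pure nodes of [s] be excluded as pure nodes of
    the circuit itself. *)
Lemma circuit_degree f r : N = (2 ^ r).-1 -> circuits K A f ->
  (tdeg f <= 12 * r + 6)%N.
Proof.
move=> Nr [[u [v [neq_uv ->]]] irr If minf].
have eq_uv : Adegree A u = Adegree A v by move/toric_binomialP: If.
have [t [s [et uE vE [es [e se]] [us conf [j walk]]]]] :=
  walk_in_binomial neq_uv (irreducible_disjoint irr) eq_uv.
rewrite uE vE in neq_uv irr minf *.
have t0 : exists i, t i != 0.
  by exists e; have := us e; rewrite /unit_conformal; move: se; lia.
have supp := circuit_support et t0 minf.
have sub i k : (k < 3)%N -> triangle s i k != 0 -> triangle t i k != 0.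
  by move=> _; have := conf i k; rewrite /conformal; lia.
have [i0 [k0 [lt_i0 lt_k0 s00]]] : exists i k, [/\ (i < N)%N, (k < 3)%N & triangle s i k != 0].
  apply: contrapT => no; move/eqP: se; apply; apply: (triangle_eq0 es) => i k lt_i lt_k.
  by apply/eqP/negPn/negP => sik; apply: no; exists i, k.
(* These coefficients make [c * t - d * s] vanish at an entry in the support of [t]; by minimality
   of the support it vanishes altogether. *)
pose c := triangle s i0 k0; pose d := triangle t i0 k0.
have proportional i : c * t i - d * s i = 0.
  apply: contrapT => /eqP nz.
  pose tau j := c * t j - d * s j.
  have etau : edge_function N tau.
    by split=> [|l leN]; rewrite /tau ?et.1 ?es.1 ?et.2 ?es.2 // !mulr0 subrr.
  have := supp tau etau (ex_intro _ i nz) _ i0 k0 lt_i0 lt_k0 (sub _ _ lt_k0 s00).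
  rewrite triangle_lin -/c -/d mulrC subrr eqxx => H; suff : false by []; apply: H.
  move=> l k lt_k; rewrite triangle_lin; apply: contraNneq => tlk.
  have /eqP slk : triangle s l k == 0 by apply: contraTT (eqxx (0 : int)) => /(sub _ _ lt_k); rewrite tlk eqxx.
  by rewrite tlk slk !mulr0 subrr.
have [lam tE] : exists lam : nat, forall i, t i = s i * lam%:Z.
  exists `|t e|%N.
  move=> i; have := unit_proportional (us e) se (proportional i) (proportional e).
  by move/eqP; rewrite mulf_eq0 (negPf s00) /= subr_eq0 => /eqP.
have partE i k : triangle t i k = triangle s i k * lam%:Z.
  by case: k => [|[|k]]; rewrite /triangle !tE; lia.
have lam1 : lam = 1%N.
  apply: (irreducible_binomial_exponent (K := K) (u := positive_part N s) (v := negative_part N s)).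
    by apply: parts_neq => //; exists e.
  suff [<- <-] : positive_part N t = (positive_part N s *+ lam)%MM /\
      negative_part N t = (negative_part N s *+ lam)%MM by [].
  split; apply/mnmP => a; rewrite mulmnE !mnmE partE.
    have [x [y [-> _ xy]]] := nonneg_partP (triangle s (a %/ 3) (a %% 3)).
    have [x' [y' [-> _ xy']]] := nonneg_partP (triangle s (a %/ 3) (a %% 3) * lam%:Z).
    by nia.
  have [x [y [_ -> xy]]] := nonneg_partP (triangle s (a %/ 3) (a %% 3)).
  have [x' [y' [_ -> xy']]] := nonneg_partP (triangle s (a %/ 3) (a %% 3) * lam%:Z).
  by nia.
have ts i k : triangle t i k = triangle s i k by rewrite partE lam1 mulr1.
rewrite tdeg_binomial //; apply: leq_trans (mdeg_part_le et) _.
have -> : triangle_norm t N = triangle_norm s N by apply: eq_bigr => i _; rewrite !ts.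
rewrite {1}Nr; apply: (walk_norm (j := j) _ es) => // i.
case: (walk i) => // pure; exfalso.
have s1 : `|s i| = 1 by have := us i; case/and3P: pure => ? _ _; rewrite /unit_conformal; lia.
have lt_i : (i < N)%N.
  by rewrite ltnNge; apply/negP => /es.2 si0; case/and3P: pure; rewrite si0 eqxx.
have [lab [_ labN labi _]] := pure_node_branches es pure s1.
(* Cutting the branch through the parent doubles entry 0 of triangle [i] and kills entry 1, so the
   support shrinks strictly without becoming empty. *)
pose tau l := if lab l == 0%N then 0 else s l.
have etau : edge_function N tau.
  by split=> [|l leN]; rewrite /tau ?es.1 ?es.2 //; case: ifP.
have tau0 : exists l, tau l != 0.
  have := labi 0%N 0%N isT isT; rewrite -/tau /= => tau_i.
  apply: contrapT => no; have tau0 l : tau l = 0 by apply/eqP/negPn/negP => ?; apply: no; exists l.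
  by move: tau_i; rewrite /triangle !tau0; lia.
have si k : (k < 3)%N -> triangle s i k = s i.
  by case/and3P: pure => _ /eqP sl /eqP sr; case: k => [|[|[|//]]] _; rewrite /triangle sl sr; lia.
have := supp tau etau tau0 _ i 1%N lt_i isT.
rewrite ts si // (labi 0%N 1%N) //= => H; suff : false by [].
have si0 : s i != 0 by case/and3P: pure.
apply: H => //.
move=> l k lt_k; rewrite ts; have [->|neq_l] := eqVneq l i; last first.
  by rewrite labN //; case: ifP; rewrite ?eqxx.
by rewrite si.
Qed.

Lemma circuit_exists : (1 < N)%N -> circuits K A !=set0.
Proof.
move=> N1; pose t i := (i == 1%N)%:Z.
have et : edge_function N t by split=> // i leN; rewrite /t (_ : (i == 1%N) = false) //; lia.
have t0 : exists i, t i != 0 by exists 1%N.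
have neq_t := parts_neq et t0.
exists ('X_[positive_part N t] - 'X_[negative_part N t]); split.
- by exists (positive_part N t), (negative_part N t).
- have [a [ea1 ea2]] := ord_of_coord N1 (isT : (1 < 3)%N).
  apply: (@irreducible_binomial K _ _ _ a); first exact: parts_disjoint.
  by left; rewrite coord_divmod ea1 ea2 positive_partE.
- exact/toric_binomial/parts_Adegree.
move=> _ [u [v [neq_uv ->]]] /toric_binomialP eq_uv [sub nsub].
have [s es dE] := diff_triangle eq_uv.
have sub' i k : (i < N)%N -> (k < 3)%N -> triangle s i k != 0 -> triangle t i k != 0.
  move=> lt_i lt_k sik; have [a [ea1 ea2]] := ord_of_coord lt_i lt_k.
  have := mem_mvars (parts_disjoint t) neq_t (diff_parts et) a.
  rewrite ea1 ea2 => <-; apply: sub; rewrite mvars_binomial // /mkset !coord_divmod ea1 ea2.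
  by move: sik; rewrite -dE // /diff; lia.
have sE := single_edge_support es sub'.
have s1 : s 1%N != 0.
  apply/eqP => s10; case/eqP: neq_uv; apply: coord_eq => i k _ lt_k.
  by have := dE i k lt_k; rewrite sE s10 mul0r /diff; lia.
apply: nsub => a /(mem_mvars (parts_disjoint t) neq_t (diff_parts et)) ta.
rewrite mvars_binomial // /mkset !coord_divmod.
have : diff u v (a %/ 3) (a %% 3) != 0 by rewrite dE ?ltn_mod // sE mulf_neq0.
by rewrite /diff; lia.
Qed.

End Degrees.

(* At a pure node [i] of [u - v], replacing the part of one of the monomials on
   each of the three branches in turn gives three elements of the fibre, all of
   them above [u], whose product is [u ^ 2 * v] or [u * v ^ 2]. *)
Lemma pair_no_pure_node N (le : rel 'X_{1..N * 3}) s i : monomial_order le ->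
  edge_function N s -> pure_node s i -> `|s i| = 1 ->
  minimal_nonstandard (@cactus N) le (positive_part N s) ->
  standard (@cactus N) le (negative_part N s) -> False.
Proof.
move=> mo es pure s1 minu stdv; set u := positive_part N s; set v := negative_part N s.
have eq_uv : Adegree (@cactus N) u = Adegree (@cactus N) v := parts_Adegree es.
have neq_uv : u != v := pair_neq minu stdv.
have [[le_refl le_anti le_trans _] _] := mo.
have lt_i : (i < N)%N.
  by rewrite ltnNge; apply/negP => /es.2 si0; case/and3P: pure; rewrite si0 eqxx.
have [lab [lab3 labN labi nbr]] := pure_node_branches es pure s1.
have si k : (k < 3)%N -> triangle s i k = s i.
  by case/and3P: pure => _ /eqP sl /eqP sr; case: k => [|[|[|//]]] _; rewrite /triangle sl sr; lia.
have dE := diff_parts es.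
have uvE j k : (k < 3)%N -> (coord u j k)%:Z - (coord v j k)%:Z = triangle s j k
    /\ (coord u j k = 0%N \/ coord v j k = 0%N).
  move=> lt_k; split; first exact: dE.
  rewrite /u /v positive_partE // negative_partE //.
  by have [? [? [-> -> ?]]] := nonneg_partP (triangle s j k); lia.
(* With [tau] the labelling cut on branch [l], this is [v] plus the vector of [tau] when [s i = 1]
   and [u] minus it when [s i = -1]. The 2 at node [i] is the doubled entry left by the cut. *)
pose w (l : nat) := of_coord N (fun j k => if j == i then (if k == l then 2 else 0)%N
  else if (lab j == l) == (s i == 1) then coord v j k else coord u j k).
have wi l k : (k < 3)%N -> coord (w l) i k = if k == l then 2%N else 0%N.
  by move=> lt_k; rewrite of_coordK // eqxx.
have wj l j k : j != i -> (j < N)%N -> (k < 3)%N ->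
    coord (w l) j k = if (lab j == l) == (s i == 1) then coord v j k else coord u j k.
  by move=> neq_j lt_j lt_k; rewrite of_coordK // (negPf neq_j).
have sgn : s i = 1 \/ s i = -1 by lia.
have w_deg l : (l < 3)%N -> Adegree (@cactus N) (w l) = Adegree (@cactus N) u.
  move=> lt_l; pose tau j := if lab j == l then 0 else s j.
  have etau : edge_function N tau.
    by split=> [|j leN]; rewrite /tau ?es.1 ?es.2 //; case: ifP.
  case: sgn => si1.
    rewrite eq_uv; apply: (triangle_diff etau) => j k lt_j lt_k; rewrite /diff.
    have := uvE j k lt_k; have [->|neq_j] := eqVneq j i.
      by rewrite wi // labi // si // si1; case: ifP; lia.
    by rewrite wj // labN // si1 eqxx; case: (lab j == l) => /=; lia.
  symmetry; apply: (triangle_diff etau) => j k lt_j lt_k; rewrite /diff.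
  have := uvE j k lt_k; have [->|neq_j] := eqVneq j i.
    by rewrite wi // labi // si // si1; case: ifP; lia.
  by rewrite wj // labN // si1; case: (lab j == l) => /=; lia.
(* By [pair_order] one variable shared with [u] suffices. For [s i = 1] it is edge [l] of the node.
   For [s i = -1] the node belongs to [v], but on branch [l], where [w l] agrees with [u], there is
   an entry of opposite sign. *)
have le_w l : (l < 3)%N -> le u (w l).
  move=> lt_l.
  have share j k : (j < N)%N -> (k < 3)%N -> coord u j k != 0%N -> coord (w l) j k != 0%N ->
      le u (w l).
    move=> lt_j lt_k uj wlj; have [a [ea1 ea2]] := ord_of_coord lt_j lt_k.
    by apply: (pair_order mo minu (i := a)); rewrite ?w_deg // coord_divmod ea1 ea2.
  case: sgn => si1.
    apply: (share i l) => //; last by rewrite wi // eqxx.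
    by have := uvE i l lt_l; rewrite si // si1; lia.
  have [j [k [neq_j lt_k lab_j neg]]] := nbr l lt_l.
  have lt_j : (j < N)%N.
    by rewrite ltnNge; apply/negP => leN; move: neg; rewrite (triangle_out _ es leN) mul0r.
  have uj : coord u j k != 0%N by have := uvE j k lt_k; rewrite si1 in neg; lia.
  by apply: (share j k) => //; rewrite wj // lab_j eqxx si1.
have le3 : le (u + u + u)%MM (w 0%N + w 1%N + w 2%N)%MM.
  by apply: (order_add mo); [apply: (order_add mo)|]; apply: le_w.
have le_vu : le v u by apply: stdv.
have sum_w : (w 0%N + w 1%N + w 2%N = u + v + (if s i == 1 then u else v))%MM.
  apply: coord_eq => j k lt_j lt_k; rewrite !coordD.
  have := uvE j k lt_k; have [->|neq_j] := eqVneq j i.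
    rewrite !wi // si //; case: k lt_k => [|[|[|//]]] _ /=;
      by case: sgn => si1; rewrite si1 /=; lia.
  by rewrite !wj //; move: (lab3 j); case: (lab j) => [|[|[|//]]] _ /=;
    case: sgn => si1; rewrite si1 /=; lia.
rewrite sum_w in le3; case/eqP: neq_uv; apply: le_anti; rewrite le_vu andbT.
move: le3; case: sgn => si1; rewrite si1 /=.
  by rewrite [(u + v)%MM]addmC -![(_ + _ + u)%MM]addmA; apply: (order_cancel mo).
(* Here cancelling [u] only gives [u + u] below [v + v]; since [v] is below [u], the latter is below
   [v + u], and another [u] cancels. *)
rewrite -[(u + v + v)%MM]addmA -[(u + u + u)%MM]addmA ![(u + (_ + _))%MM]addmC.
move/(order_cancel mo) => le_uv; apply: (order_cancel mo (w := u)).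
by apply: le_trans le_uv _; apply: (order_add mo).
Qed.

(** By [pair_primitive] the pair is itself the walk found below it. The bound is used twice: for the
    universal Groebner basis, and for the finiteness that lets a reduced basis exist. *)
Lemma pair_degree r N (le : rel 'X_{1..N * 3}) u v : N = (2 ^ r).-1 ->
  monomial_order le -> minimal_nonstandard (@cactus N) le u ->
  standard (@cactus N) le v -> Adegree (@cactus N) u = Adegree (@cactus N) v ->
  (maxn (mdeg u) (mdeg v) <= 12 * r + 6)%N.
Proof.
move=> Nr mo minu stdv eq_uv; have neq_uv := pair_neq minu stdv.
have disj := pair_disjoint mo minu stdv eq_uv.
have [t [s [et uE vE [es s0] [us conf [j walk]]]]] := walk_in_binomial neq_uv disj eq_uv.
have [le1 le2] := conformal_parts es et conf; rewrite -uE -vE in le1 le2.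
have [us' vs'] := pair_primitive mo minu stdv eq_uv le1 le2
  (parts_Adegree es) (parts_neq es s0).
rewrite -us' -vs' in minu stdv *; apply: leq_trans (mdeg_part_le es) _.
rewrite {1}Nr; apply: (walk_norm (j := j) _ es) => i; case: (walk i) => // pure.
have s1 : `|s i| = 1 by have := us i; case/and3P: pure => ? _ _; rewrite /unit_conformal; lia.
by case: (pair_no_pure_node mo es pure s1 minu stdv).
Qed.

Lemma universal_groebner_degree (K : fieldType) r N f : N = (2 ^ r).-1 ->
  universal_groebner_basis K (@cactus N) f -> (tdeg f <= 12 * r + 6)%N.
Proof.
move=> Nr [le [G [mo redG Gf]]].
have [u [v [minu stdv eq_uv ->]]] := reduced_groebner_pair mo redG Gf.
rewrite tdeg_binomial; last exact: pair_neq minu stdv.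
exact: pair_degree minu stdv eq_uv.
Qed.

Theorem theorem3p5 (K : fieldType) (R : realType) (p : {poly R}) :
  exists (n m : nat) (A : 'I_m -> 'rV[int]_n) (M : set {mpoly K[m]}),
    [/\ injective A, (forall i j, 0 <= A i 0 j), markov_basis A M &
      exists dGr dC dU dM : nat,
        [/\ max_degree (graver_basis K A) dGr,
            max_degree (circuits K A) dC,
            max_degree (universal_groebner_basis K A) dU
          & max_degree M dM] /\
        [/\ p.[dC%:R] < dGr%:R,
            p.[dU%:R] < dGr%:R
          & p.[dM%:R] < dGr%:R]].
Proof.
have [C [k le_p]] := horner_le_nat p.
have [r [r1 lt_r]] := polynomial_lt_exp C k.
pose N := (2 ^ r).-1; have N2 : (2 < N)%N.
  have : (2 ^ 2 <= 2 ^ r)%N by rewrite leq_exp2l.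
  by rewrite /N; lia.
pose A := @cactus N; pose B := (12 * r + 6)%N.
have mo := mnmc_monomial_order (N * 3).
have [|G redG genG] := @reduced_groebner_exists K _ _ A _ mo (@cactus_graded N) B.
  move=> u v minu stdv eq_uv.
  by apply: leq_trans (pair_degree (erefl N) mo minu stdv eq_uv); rewrite leq_maxl.
have GU : [set` G] `<=` universal_groebner_basis K A by move=> f Gf; exists (@mnmc_le _), G.
have UB f : universal_groebner_basis K A f -> (tdeg f <= B)%N.
  exact: universal_groebner_degree.
have [M [sMG genM minM]] := minimal_generators G; rewrite genG in genM minM.
have [f0 circ0] : circuits K A !=set0 by apply: circuit_exists; lia.
(* A maximal degree requires a nonempty set; an empty [M] would make the ideal zero, whereas it
   contains a circuit. *)
have M0 : M !=set0.
  apply/set0P/eqP => M0; case: circ0 => _ [nz _ _] + _.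
  by rewrite -genM M0 => /ideal_gen_set0 /= f00; rewrite f00 eqxx in nz.
have [g grg leg] := graver_large K N2.
have [dGr maxGr _] : exists2 d, max_degree (graver_basis K A) d & (d <= 9 * N)%N.
  by apply: max_degree_exists => [|f]; [exists g|apply: graver_degree].
have [dC maxC leC] : exists2 d, max_degree (circuits K A) d & (d <= B)%N.
  by apply: max_degree_exists => [|f]; [exists f0|apply: circuit_degree].
have [dU maxU leU] : exists2 d, max_degree (universal_groebner_basis K A) d & (d <= B)%N.
  by apply: max_degree_exists => //; case: M0 => f Mf; exists f; apply/GU/sMG.
have [dM maxM leM] : exists2 d, max_degree M d & (d <= B)%N.
  by apply: max_degree_exists => // f Mf; apply/UB/GU/sMG.
exists (N.*2.+1), (N * 3)%N, A, M; split.
- exact: cactus_inj.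
- exact: cactus_ge0.
- split=> // f Mf.
  have [u [v [minu stdv eq_uv ->]]] := reduced_groebner_pair mo redG (sMG f Mf).
  by exists u, v; split=> //; apply: pair_neq minu stdv.
exists dGr, dC, dU, dM; split; first by split.
have large : (2 ^ r - 2 <= dGr)%N.
  by apply: leq_trans (maxGr.2 g grg); apply: leq_trans leg; rewrite /N; lia.
have bound d : (d <= B)%N -> p.[d%:R] < dGr%:R.
  move=> le_dB; apply: le_lt_trans (le_p d) _; rewrite ltr_nat.
  apply: leq_trans large; apply: leq_ltn_trans lt_r.
  rewrite leq_mul2l; apply/orP; right.
  by case: (k) => // k'; rewrite leq_exp2r //; rewrite /B in le_dB; lia.
by split; apply: bound.
Qed.
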